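(* Let $(V,\{\nu_n\})$ be an $L^\infty$-MOS, let $S\subseteq V$ be a self-adjoint subspace endowed with the restricted order gauges $\nu_n|_{M_n(S)_{sa}}$, and let $H$ be a Hilbert space, with $B(H)$ endowed with the order gauges $d_{n,B(H)}$. If $\phi:S\to B(H)$ is completely gauge-contractive, then there exists a completely gauge-contractive map $\tilde\phi:V\to B(H)$ extending $\phi$.
   Context: An $L^\infty$-MOS is a complex $*$-vector space $V$ ($M_n(V)$ with $(x_{ij})^*=(x_{ji}^* )$, self-adjoint part $M_n(V)_{sa}$) with proper gauges $\nu_n:M_n(V)_{sa}\to[0,\infty)$ (subadditive, positively homogeneous, $\nu_n(A)=\nu_n(-A)=0\Rightarrow A=0$) such that $\nu_k(X^*AX)\le\|X\|^2\nu_n(A)$ for scalar $X\in M_{n,k}$ and $\nu_{n+k}(A\oplus B)=\max\{\nu_n(A),\nu_k(B)\}$. For $T\in M_n(B(H))_{sa}\cong B(H^n)_{sa}$, $d_{n,B(H)}(T)=\inf\{\|T+P\|:P\ge0\}=\inf\{t>0:T\le tI\}$. A linear map $\phi$ is completely gauge-contractive if $\phi(x^* )=\phi(x)^*$ and $\omega_n(\phi^{(n)}(A))\le\nu_n(A)$ for all $n$ and self-adjoint $A\in M_n$ of the domain, where $\omega_n$ are the order gauges of the codomain. *)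

(* Defs.v *)
From Stdlib Require Import Reals ClassicalEpsilon.
From mathcomp Require Import all_boot.
Set Implicit Arguments. Unset Strict Implicit. Unset Printing Implicit Defensive.

Local Open Scope R_scope.

Record C := mkC { cre : R ; cim : R }.
Definition C0 : C := mkC 0 0.
Definition C1 : C := mkC 1 0.
Definition RtoC (r : R) : C := mkC r 0.
Definition Cadd (a b : C) : C := mkC (cre a + cre b) (cim a + cim b).
Definition Cmul (a b : C) : C :=
  mkC (cre a * cre b - cim a * cim b) (cre a * cim b + cim a * cre b).
Definition Cconj (a : C) : C := mkC (cre a) (- cim a).
Definition Cabs2 (a : C) : R := cre a * cre a + cim a * cim a.

Definition bsum (X : Type) (z : X) (add : X -> X -> X) (n : nat) (f : 'I_n -> X) : X :=
  foldr add z (map f (enum 'I_n)).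
Definition rsum n (f : 'I_n -> R) : R := bsum 0 Rplus f.
Definition csum n (f : 'I_n -> C) : C := bsum C0 Cadd f.

Definition Rsup (P : R -> Prop) : R := epsilon (inhabits 0) (fun s => is_lub P s).
Definition Rinf (P : R -> Prop) : R := - Rsup (fun x => P (- x)).

Record cvs_axioms (T : Type) (z : T) (add : T -> T -> T) (opp : T -> T)
    (scal : C -> T -> T) : Prop := {
  ax_addA : forall x y w, add x (add y w) = add (add x y) w;
  ax_addC : forall x y, add x y = add y x;
  ax_add0 : forall x, add z x = x;
  ax_addN : forall x, add (opp x) x = z;
  ax_scalA : forall a b x, scal a (scal b x) = scal (Cmul a b) x;
  ax_scal1 : forall x, scal C1 x = x;
  ax_scalDr : forall a x y, scal a (add x y) = add (scal a x) (scal a y);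
  ax_scalDl : forall a b x, scal (Cadd a b) x = add (scal a x) (scal b x)
}.

Record StarVS := {
  sv :> Type;
  sv0 : sv;
  svadd : sv -> sv -> sv;
  svopp : sv -> sv;
  svscal : C -> sv -> sv;
  svstar : sv -> sv;
  sv_ax : cvs_axioms sv0 svadd svopp svscal;
  svstarD : forall x y, svstar (svadd x y) = svadd (svstar x) (svstar y);
  svstarZ : forall a x, svstar (svscal a x) = svscal (Cconj a) (svstar x);
  svstarK : forall x, svstar (svstar x) = x
}.

Definition mx (T : Type) (n m : nat) := 'I_n -> 'I_m -> T.

Section VMatrices.
Variable V : StarVS.
Definition vsum n (f : 'I_n -> V) : V := bsum (sv0 V) (@svadd V) f.
Definition madd n (A B : mx V n n) : mx V n n := fun i j => svadd (A i j) (B i j).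
Definition mopp n (A : mx V n n) : mx V n n := fun i j => svopp (A i j).
Definition mscal n (c : C) (A : mx V n n) : mx V n n := fun i j => svscal c (A i j).
Definition is_sa n (A : mx V n n) : Prop := forall i j, A i j = svstar (A j i).
Definition mx_cong n k (X : mx C n k) (A : mx V n n) : mx V k k :=
  fun i j => vsum (fun p => vsum (fun q => svscal (Cmul (Cconj (X p i)) (X q j)) (A p q))).
Definition dsum n k (A : mx V n n) (B : mx V k k) : mx V (n + k)%N (n + k)%N :=
  fun i j => match split i, split j with
             | inl a, inl b => A a b
             | inr a, inr b => B a b
             | _, _ => sv0 V
             end.
End VMatrices.

Definition cvnorm n (v : 'I_n -> C) : R := sqrt (rsum (fun i => Cabs2 (v i))).
Definition cmxmulv n k (X : mx C n k) (v : 'I_k -> C) : 'I_n -> C :=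
  fun i => csum (fun j => Cmul (X i j) (v j)).
Definition mxnorm n k (X : mx C n k) : R :=
  Rsup (fun r => exists v, cvnorm v <= 1 /\ r = cvnorm (cmxmulv X v)).

Record LinfMOS := {
  mos_V :> StarVS;
  nu : forall n, mx mos_V n n -> R;
  nu_nonneg : forall n (A : mx mos_V n n), is_sa A -> 0 <= nu A;
  nu_subadd : forall n (A B : mx mos_V n n), is_sa A -> is_sa B ->
      nu (madd A B) <= nu A + nu B;
  nu_homog : forall n (t : R) (A : mx mos_V n n), 0 < t -> is_sa A ->
      nu (mscal (RtoC t) A) = t * nu A;
  nu_proper : forall n (A : mx mos_V n n), is_sa A ->
      nu A = 0 -> nu (mopp A) = 0 -> forall i j, A i j = sv0 mos_V;
  nu_cong : forall n k (X : mx C n k) (A : mx mos_V n n), is_sa A ->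
      nu (mx_cong X A) <= (mxnorm X) ^ 2 * nu A;
  nu_dsum : forall n k (A : mx mos_V n n) (B : mx mos_V k k), is_sa A -> is_sa B ->
      nu (dsum A B) = Rmax (nu A) (nu B)
}.

Definition sa_subspace (V : StarVS) (S : V -> Prop) : Prop :=
  S (sv0 V) /\ (forall x y, S x -> S y -> S (svadd x y)) /\
  (forall a x, S x -> S (svscal a x)) /\ (forall x, S x -> S (svstar x)).

Record CHilbert := {
  hs :> Type;
  h0 : hs;
  hadd : hs -> hs -> hs;
  hopp : hs -> hs;
  hscal : C -> hs -> hs;
  h_ax : cvs_axioms h0 hadd hopp hscal;
  ip : hs -> hs -> C;
  ip_addl : forall x y w, ip (hadd x y) w = Cadd (ip x w) (ip y w);
  ip_scall : forall a x y, ip (hscal a x) y = Cmul a (ip x y);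
  ip_conj : forall x y, ip y x = Cconj (ip x y);
  ip_pos : forall x, 0 <= cre (ip x x);
  ip_def : forall x, ip x x = C0 -> x = h0;
  h_complete : forall u : nat -> hs,
      (forall eps, 0 < eps -> exists N, forall m p, (N <= m)%nat -> (N <= p)%nat ->
          sqrt (cre (ip (hadd (u m) (hopp (u p))) (hadd (u m) (hopp (u p))))) < eps) ->
      exists l, forall eps, 0 < eps -> exists N, forall m, (N <= m)%nat ->
          sqrt (cre (ip (hadd (u m) (hopp l)) (hadd (u m) (hopp l)))) < eps
}.

Section Operators.
Variable H : CHilbert.
Definition hnorm (x : H) : R := sqrt (cre (ip x x)).
Definition bounded_op (T : H -> H) : Prop :=
  (forall x y, T (hadd x y) = hadd (T x) (T y)) /\
  (forall a x, T (hscal a x) = hscal a (T x)) /\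
  (exists M, forall x, hnorm (T x) <= M * hnorm x).
Definition is_adj (T S : H -> H) : Prop := forall x y, ip (T x) y = ip x (S y).
(* T in M_n(B(H)) = B(H^n) satisfies T <= t I *)
Definition op_le_tI n (T : mx (H -> H) n n) (t : R) : Prop :=
  forall xi : 'I_n -> H,
    cre (csum (fun i => csum (fun j => ip (T i j (xi j)) (xi i))))
      <= t * rsum (fun i => cre (ip (xi i) (xi i))).
Definition d_BH n (T : mx (H -> H) n n) : R := Rinf (fun t => 0 < t /\ op_le_tI T t).
End Operators.

Definition op_linear_on (V : StarVS) (H : CHilbert) (S : V -> Prop) (phi : V -> H -> H) :=
  (forall x, S x -> bounded_op (phi x)) /\
  (forall x y, S x -> S y -> forall xi, phi (svadd x y) xi = hadd (phi x xi) (phi y xi)) /\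
  (forall a x, S x -> forall xi, phi (svscal a x) xi = hscal a (phi x xi)).

Definition cgc_on (V : LinfMOS) (H : CHilbert) (S : V -> Prop) (phi : V -> H -> H) :=
  (forall x, S x -> is_adj (phi x) (phi (svstar x))) /\
  (forall n (A : mx V n n), (forall i j, S (A i j)) -> is_sa A ->
      d_BH (fun i j => phi (A i j)) <= nu A).

(* Main.v *)
(* Let W be the real vector space spanned by the tensors
     A.xi = sum_ij A_ij (x) xi_j (x) conj xi_i,   A in M_n(V)_sa, xi in H^n.
   A linear map phi : S -> B(H) amounts to the functional
     f(B.eta) = Re sum_ij <phi(B_ij) eta_j, eta_i>
   on the part of W that lives over S, and phi is completely gauge-contractive iff
   f(B.eta) <= nu(B) |eta|^2.  Because nu(A (+) A') = max(nu A, nu A'), the function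
   p(w) = inf { |xi|^2 : w = A.xi, nu A <= 1 } is sublinear, so Hahn-Banach extends
   f to a functional l <= p on all of W, provided f <= p where f is defined.  This
   holds because any representation of a tensor over S can be compressed by an
   isometry U to one with linearly independent vectors; the entries of U^* A U then
   lie in S, and nu(U^* A U) <= nu A.  The extension psi(x) is the operator given, by
   Riesz, by the bounded sesquilinear form that l induces on H.  Taking all of H at
   once avoids the usual reduction to finite-dimensional compressions. *)

From HB Require Import structures.
From Stdlib Require Import Reals Lra ClassicalEpsilon.
From mathcomp Require Import all_boot ssralg.
From mathcomp Require Import boolp classical_sets functions.
Require Import Defs.
Set Implicit Arguments. Unset Strict Implicit. Unset Printing Implicit Defensive.
Import GRing.Theory.

Delimit Scope R_scope with coqR.
Local Open Scope ring_scope.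

(** * The scalars and vector spaces as algebraic structures *)

Definition Copp (a : C) : C := mkC (- cre a)%coqR (- cim a)%coqR.

Lemma C_ext (a b : C) : cre a = cre b -> cim a = cim b -> a = b.
Proof. by case: a b => [? ?] [? ?] /= -> ->. Qed.

Lemma CaddA : associative Cadd.
Proof. by move=> a b c; apply: C_ext => /=; lra. Qed.
Lemma CaddC : commutative Cadd.
Proof. by move=> a b; apply: C_ext => /=; lra. Qed.
Lemma Cadd0 : left_id C0 Cadd.
Proof. by move=> a; apply: C_ext => /=; lra. Qed.
Lemma CaddN : left_inverse C0 Copp Cadd.
Proof. by move=> a; apply: C_ext => /=; lra. Qed.
Lemma CmulA : associative Cmul.
Proof. by move=> a b c; apply: C_ext => /=; nra. Qed.
Lemma CmulC : commutative Cmul.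
Proof. by move=> a b; apply: C_ext => /=; nra. Qed.
Lemma Cmul1 : left_id C1 Cmul.
Proof. by move=> a; apply: C_ext => /=; lra. Qed.
Lemma CmulDl : left_distributive Cmul Cadd.
Proof. by move=> a b c; apply: C_ext => /=; nra. Qed.

HB.instance Definition _ := gen_eqMixin C.
HB.instance Definition _ := gen_choiceMixin C.
HB.instance Definition _ := GRing.isZmodule.Build C CaddA CaddC Cadd0 CaddN.

Lemma C1_neq0 : C1 != 0 :> C.
Proof. by apply/eqP => -[]; lra. Qed.

HB.instance Definition _ :=
  GRing.Zmodule_isComNzRing.Build C CmulA CmulC Cmul1 CmulDl C1_neq0.

Lemma Cconj_additive : zmod_morphism Cconj.
Proof. by move=> a b; apply: C_ext => /=; lra. Qed.
Lemma Cconj_monoid : monoid_morphism Cconj.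
Proof. by split=> [|a b]; apply: C_ext => /=; lra. Qed.
HB.instance Definition _ := GRing.isZmodMorphism.Build C C Cconj Cconj_additive.
HB.instance Definition _ := GRing.isMonoidMorphism.Build C C Cconj Cconj_monoid.

Lemma CconjK : involutive Cconj.
Proof. by move=> a; apply: C_ext => /=; lra. Qed.

Lemma RtoCD (s t : R) : RtoC (s + t) = RtoC s + RtoC t.
Proof. by apply: C_ext => /=; lra. Qed.
Lemma RtoCM (s t : R) : RtoC (s * t) = RtoC s * RtoC t.
Proof. by apply: C_ext => /=; lra. Qed.

(** Reduces signs to real scalars, so the rules for [RtoC] multiples under the involution, [rip] and
    [l] also handle negation. *)
Lemma opp_scal (E : lmodType C) (x : E) : - x = RtoC (-1) *: x.
Proof. by rewrite -scaleN1r; congr (_ *: _); apply: C_ext => /=; lra. Qed.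

Section StarVSInstances.
Variable V : StarVS.
HB.instance Definition _ := gen_eqMixin (sv V).
HB.instance Definition _ := gen_choiceMixin (sv V).
HB.instance Definition _ := GRing.isZmodule.Build (sv V)
  (ax_addA (sv_ax V)) (ax_addC (sv_ax V)) (ax_add0 (sv_ax V)) (ax_addN (sv_ax V)).
HB.instance Definition _ := GRing.Zmodule_isLmodule.Build C (sv V)
  (ax_scalA (sv_ax V)) (ax_scal1 (sv_ax V)) (ax_scalDr (sv_ax V))
  (fun v a b => ax_scalDl (sv_ax V) a b v).
End StarVSInstances.

Section HilbertInstances.
Variable H : CHilbert.
HB.instance Definition _ := gen_eqMixin (hs H).
HB.instance Definition _ := gen_choiceMixin (hs H).
HB.instance Definition _ := GRing.isZmodule.Build (hs H)
  (ax_addA (h_ax H)) (ax_addC (h_ax H)) (ax_add0 (h_ax H)) (ax_addN (h_ax H)).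
HB.instance Definition _ := GRing.Zmodule_isLmodule.Build C (hs H)
  (ax_scalA (h_ax H)) (ax_scal1 (h_ax H)) (ax_scalDr (h_ax H))
  (fun v a b => ax_scalDl (h_ax H) a b v).
End HilbertInstances.

(** * Finite sums, the involution and abstract inner products *)

Lemma bsumE (X : Type) (z : X) (op : X -> X -> X) n (f : 'I_n -> X) :
  bsum z op f = \big[op/z]_(i < n) f i.
Proof. by rewrite /bsum foldrE big_map enumT [index_enum _]unlock. Qed.

Lemma csumE n (f : 'I_n -> C) : csum f = \sum_i f i.
Proof. exact: bsumE. Qed.
Lemma vsumE (V : StarVS) n (f : 'I_n -> V) : vsum f = \sum_i f i.
Proof. exact: bsumE. Qed.

Lemma cre_sum (I : Type) (r : seq I) (P : pred I) (F : I -> C) :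
  cre (\sum_(i <- r | P i) F i) = \big[Rplus/0%coqR]_(i <- r | P i) cre (F i).
Proof. exact: (big_morph cre (id2 := C0)). Qed.

(** Transports real sums to [C], where the big-operator lemmas for rings apply. *)
Lemma rsumE n (f : 'I_n -> R) : rsum f = cre (\sum_i RtoC (f i)).
Proof. by rewrite cre_sum; exact: bsumE. Qed.

Lemma RtoC_rsum n (f : 'I_n -> R) : RtoC (rsum f) = \sum_i RtoC (f i).
Proof.
rewrite /rsum bsumE.
exact: (big_morph RtoC RtoCD (erefl (RtoC 0))).
Qed.

Lemma rsum_split n k (f : 'I_(n + k) -> R) :
  rsum f = (rsum (fun i => f (lshift k i)) + rsum (fun i => f (rshift n i)))%coqR.
Proof. by rewrite !rsumE big_split_ord. Qed.

Section Star.
Variable V : StarVS.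
Implicit Types x y : V.
Lemma star_additive : zmod_morphism (@svstar V).
Proof.
move=> x y; rewrite [- y]opp_scal.
rewrite -[svstar _]/(svstar (svadd x (svscal _ y))) svstarD svstarZ.
have -> : Cconj (RtoC (-1)) = -1 by apply: C_ext => /=; lra.
exact: (congr1 (svadd _) (scaleN1r _)).
Qed.
HB.instance Definition _ :=
  GRing.isZmodMorphism.Build V V (@svstar V) star_additive.
Lemma starZ (a : C) x : svstar (a *: x) = Cconj a *: svstar x.
Proof. exact: svstarZ. Qed.
End Star.

Section InnerProduct.
Variable H : CHilbert.
Implicit Types x y z : H.
Lemma ipDl x y z : ip (x + y) z = ip x z + ip y z. Proof. exact: ip_addl. Qed.
Lemma ipZl a x y : ip (a *: x) y = a * ip x y. Proof. exact: ip_scall. Qed.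
Lemma ipJ x y : Cconj (ip x y) = ip y x. Proof. by rewrite -ip_conj. Qed.
End InnerProduct.

(* A complex inner product, in the generality needed to treat [H] and [C^n] at once. *)
Record inner_product (E : lmodType C) (f : E -> E -> C) : Prop := {
  innerDl : forall x y z, f (x + y) z = f x z + f y z;
  innerZl : forall a x y, f (a *: x) y = a * f x y;
  innerJ : forall x y, Cconj (f x y) = f y x;
  inner_ge0 : forall x, (0 <= cre (f x x))%coqR;
  inner_eq0 : forall x, f x x = 0 -> x = 0
}.

Section Inner.
Variables (E : lmodType C) (f : E -> E -> C).
Hypothesis ipf : inner_product f.
Implicit Types x y z : E.

Lemma innerDr x y z : f x (y + z) = f x y + f x z.
Proof. by rewrite -(innerJ ipf) (innerDl ipf) rmorphD /= !(innerJ ipf). Qed.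
Lemma innerZr a x y : f x (a *: y) = Cconj a * f x y.
Proof. by rewrite -(innerJ ipf) (innerZl ipf) rmorphM /= (innerJ ipf). Qed.
Lemma inner0l y : f 0 y = 0.
Proof. by rewrite -(scale0r (0 : E)) (innerZl ipf) mul0r. Qed.
Lemma inner0r y : f y 0 = 0.
Proof. by rewrite -(innerJ ipf) inner0l rmorph0. Qed.
Lemma innerNl x y : f (- x) y = - f x y.
Proof. by rewrite -scaleN1r (innerZl ipf) mulN1r. Qed.
Lemma inner_suml I (r : seq I) (P : pred I) (F : I -> E) y :
  f (\sum_(i <- r | P i) F i) y = \sum_(i <- r | P i) f (F i) y.
Proof.
exact: (big_morph (f^~ y) (fun a b => innerDl ipf a b y) (inner0l y)).
Qed.
Lemma inner_sumr I (r : seq I) (P : pred I) (F : I -> E) y :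
  f y (\sum_(i <- r | P i) F i) = \sum_(i <- r | P i) f y (F i).
Proof. exact: (big_morph (f y) (innerDr y) (inner0r y)). Qed.
Lemma inner_real x : f x x = RtoC (cre (f x x)).
Proof.
have := innerJ ipf x x; case: (f x x) => a b [] h.
by apply: C_ext => //=; lra.
Qed.
Lemma inner_gt0 x : x <> 0 -> (0 < cre (f x x))%coqR.
Proof.
move=> x0; case: (inner_ge0 ipf x) => // h.
by case: x0; apply: (inner_eq0 ipf); rewrite inner_real -h.
Qed.
End Inner.

Lemma ip_inner (H : CHilbert) : inner_product (@ip H).
Proof.
split; [exact: ipDl | exact: ipZl | exact: ipJ | exact: ip_pos | exact: ip_def].
Qed.

(** * Hahn-Banach *)

Lemma Rsup_lub (P : R -> Prop) : bound P -> (exists x, P x) -> is_lub P (Rsup P).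
Proof.
move=> bP exP; have [s Hs] := completeness P bP exP.
exact: (epsilon_spec (inhabits 0%coqR) (fun s => is_lub P s) (ex_intro _ s Hs)).
Qed.

(** [Rsup] chooses by epsilon; nonemptiness and boundedness guarantee that the chosen number is a
    genuine bound. *)
Lemma Rinf_glb (P : R -> Prop) :
  (exists x, P x) -> (exists b, forall x, P x -> (b <= x)%coqR) ->
  (forall x, P x -> (Rinf P <= x)%coqR) /\
  (forall b, (forall x, P x -> (b <= x)%coqR) -> (b <= Rinf P)%coqR).
Proof.
move=> [x0 Px0] [b hb].
have [||ub lub] := @Rsup_lub (fun x => P (- x)%coqR).
- by exists (- b)%coqR => x /hb; lra.
- by exists (- x0)%coqR; rewrite Ropp_involutive.
rewrite /Rinf; split=> [x Px|c hc].
  by have := ub (- x)%coqR; rewrite Ropp_involutive => /(_ Px); lra.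
by have := lub (- c)%coqR; (have h x : P (- x)%coqR -> (x <= - c)%coqR
    by move=> /hc; lra); move/(_ h); lra.
Qed.

(** [K w r] plays the role of p(w) <= r for a partially defined sublinear p. Working with the
    epigraph avoids taking infima before boundedness is known; [cone_pos] is p(0) >= 0. *)
Record proper_cone (E : lmodType C) (K : E -> R -> Prop) : Prop := {
  coneD : forall w w' r r', K w r -> K w' r' -> K (w + w') (r + r')%coqR;
  coneZ : forall t w r, (0 < t)%coqR -> K w r -> K (RtoC t *: w) (t * r)%coqR;
  cone_pos : forall r, K 0 r -> (0 <= r)%coqR
}.

Lemma RtoC0 : RtoC 0 = 0. Proof. by []. Qed.
Lemma RtoC1 : RtoC 1 = 1. Proof. by []. Qed.

Section HahnBanach.
Variables (E : lmodType C) (K : E -> R -> Prop).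
Hypotheses (coneK : proper_cone K) (K0 : K 0 0%coqR).

(* In a maximal cone containing [K], a point [(w, r)] is left out only because
   adding it would produce some [(0, s)] with [s < 0]. *)
Lemma maximal_cone : exists M : E -> R -> Prop,
  [/\ proper_cone M, forall w r, K w r -> M w r &
      forall w r, M w r \/ exists s, (s < - r)%coqR /\ M (- w) s].
Proof.
(* Zorn is applied to sets added to [K]: the union over the empty chain then still yields [K], and
   every candidate contains [K]. *)
pose up (A : set (E * R)) w r := K w r \/ A (w, r).
pose good (A : set (E * R)) := proper_cone (up A).
have [|A [gA maxA]] := @Zorn_bigcup (E * R)%type good.
  move=> F Fgood Ftot.
  have upF w r : up (\bigcup_(X in F) X)%classic w r ->
      K w r \/ exists2 X, F X & X (w, r).
    by case=> [|[X FX Xw]]; [left | right; exists X].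
  have inF X w r : F X -> up X w r -> up (\bigcup_(X in F) X)%classic w r.
    by move=> FX [|Xw]; [left | right; exists X].
  split.
  - move=> w w' r r' /upF [Kw|[X FX Xw]] /upF [Kw'|[Y FY Yw']].
    + by left; exact: coneD Kw Kw'.
    + by apply: (inF Y) => //; apply: (coneD (Fgood _ FY)); [left | right].
    + by apply: (inF X) => //; apply: (coneD (Fgood _ FX)); [right | left].
    + case: (Ftot X Y FX FY) => sub.
        apply: (inF Y) => //; apply: (coneD (Fgood _ FY)); right => //.
        exact: sub.
      apply: (inF X) => //; apply: (coneD (Fgood _ FX)); right => //.
      exact: sub.
  - move=> t w r t0 /upF [Kw|[X FX Xw]].
      by left; exact: coneZ.
    by apply: (inF X) => //; apply: (coneZ (Fgood _ FX)) => //; right.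
  - move=> r /upF [Kw|[X FX Xw]]; first exact: cone_pos coneK _ Kw.
    by apply: (cone_pos (Fgood _ FX)); right.
exists (up A); split=> // [w r Kw|w r]; first by left.
have up0 : up A 0 0%coqR by left.
case: (pselect (up A w r)) => [|nM]; [by left | right].
(* [B] is the cone generated by [up A] and the ray through (w, r); by maximality it fails to be
   proper. *)
pose B : set (E * R) := fun us => exists t u s, [/\ (0 <= t)%coqR, up A u s &
  us = (u + RtoC t *: w, (s + t * r)%coqR)].
have AB : (A `<=` B)%classic.
  move=> [u s] Aus; exists 0%coqR, u, s; split; first by lra.
    by right.
  by rewrite RtoC0 scale0r addr0; congr (_, _); lra.
have upB u s : up B u s <-> B (u, s).
  split=> [[Ku|//]|]; last by right.
  exists 0%coqR, u, s; split; [by lra | by left | ].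
  by rewrite RtoC0 scale0r addr0; congr (_, _); lra.
have Bwr : B (w, r).
  exists 1%coqR, 0, 0%coqR; split=> //; first by lra.
  by rewrite RtoC1 scale1r add0r; congr (_, _); lra.
have /maxA nB : (A `<` B)%classic.
  by split=> // BA; apply: nM; right; exact: BA.
have [s [s0 Bs]] : exists s, (s < 0)%coqR /\ B (0, s).
  apply: contrapT => nneg; apply: nB; split.
  - move=> u u' s s' /upB [t [v [z [t0 Mv [-> ->]]]]] /upB.
    move=> [t' [v' [z' [t0' Mv' [-> ->]]]]]; apply/upB.
    exists (t + t')%coqR, (v + v'), (z + z')%coqR; split; first by lra.
      exact: coneD.
    by rewrite RtoCD scalerDl addrACA; congr (_, _); lra.
  - move=> t u s t0 /upB [t' [v [z [t0' Mv [-> ->]]]]]; apply/upB.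
    exists (t * t')%coqR, (RtoC t *: v), (t * z)%coqR; split; first by nra.
      exact: coneZ.
    by rewrite RtoCM scalerDr scalerA; congr (_, _); lra.
  - move=> s /upB Bs; apply: Rnot_lt_le => s0; apply: nneg.
    by exists s.
case: Bs => t [u [z [t0 Mu [u0 sE]]]].
(* With t = 0 the bad point (0, s) would already lie in [up A]. For t > 0, dividing by t puts -w at
   height z / t, and z + t r = s < 0 makes this smaller than -r. *)
have {}t0 : (0 < t)%coqR.
  case: t0 => // t0; move: u0 sE; rewrite -t0 RtoC0 scale0r addr0 => u0 sE.
  move: Mu; rewrite -u0 => /(cone_pos gA); lra.
exists (/ t * z)%coqR; split.
  apply: (Rmult_lt_reg_l t) => //; rewrite -Rmult_assoc Rinv_r; lra.
have -> : - w = RtoC (/ t) *: u.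
  have -> : u = - (RtoC t *: w) by apply/eqP; rewrite -addr_eq0 -u0.
  by rewrite scalerN scalerA -RtoCM Rinv_l ?RtoC1 ?scale1r //; lra.
by apply: coneZ => //; exact: Rinv_0_lt_compat.
Qed.

(** On the subspace of those w for which [M] has points over both w and -w, the infimum of [M w] is
    finite and sublinear. The dichotomy of [maximal_cone] makes it odd, and an odd sublinear
    function is linear. The hypothesis on -w places all of the domain of [K] in this subspace. *)
Lemma hahn_banach_cone :
  (forall w r, K w r -> exists s, K (- w) s) ->
  exists l : E -> R,
  [/\ forall w w' r r', K w r -> K w' r' -> l (w + w') = (l w + l w')%coqR,
      forall w r t, K w r -> l (RtoC t *: w) = (t * l w)%coqR &
      forall w r, K w r -> (l w <= r)%coqR].
Proof.
move=> KN; have [M [coneM KM dich]] := maximal_cone.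
pose D w := (exists r, M w r) /\ (exists r, M (- w) r).
have DK w r : K w r -> D w.
  by move=> Kw; split; [exists r; exact: KM | have [s /KM] := KN _ _ Kw; exists s].
have DN w : D w -> D (- w) by case=> h1 h2; split; rewrite ?opprK.
have DD w w' : D w -> D w' -> D (w + w').
  move=> [[r Mr] [s Ms]] [[r' Mr'] [s' Ms']]; split.
    by exists (r + r')%coqR; exact: coneD.
  by exists (s + s')%coqR; rewrite opprD; exact: coneD.
have MN w r s : M w r -> M (- w) s -> (0 <= r + s)%coqR.
  by move=> Mr Ms; have := coneD coneM Mr Ms; rewrite subrr; exact: cone_pos.
pose l w := Rinf (M w).
have lP w : D w -> (forall r, M w r -> (l w <= r)%coqR) /\
    (forall b, (forall r, M w r -> (b <= r)%coqR) -> (b <= l w)%coqR).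
  move=> [[r Mr] [s Ms]]; apply: Rinf_glb; first by exists r.
  by exists (- s)%coqR => x Mx; have := MN _ _ _ Mx Ms; lra.
have lsub w w' : D w -> D w' -> (l (w + w')%R <= l w + l w')%coqR.
  move=> Dw Dw'; have [lw gw] := lP _ Dw; have [lw' gw'] := lP _ Dw'.
  have [lD _] := lP _ (DD _ _ Dw Dw').
  suff : (l (w + w')%R - l w <= l w')%coqR by lra.
  apply: gw' => r' Mr'.
  suff : (l (w + w')%R - r' <= l w)%coqR by lra.
  apply: gw => r Mr.
  by have := lD _ (coneD coneM Mr Mr'); lra.
have lN w : D w -> l (- w) = (- l w)%coqR.
  move=> Dw; have [lw gw] := lP _ Dw; have [lNw gNw] := lP _ (DN _ Dw).
  apply: Rle_antisym; last first.
    apply: gNw => s Ms; suff : (- s <= l w)%coqR by lra.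
    by apply: gw => r Mr; have := MN _ _ _ Mr Ms; lra.
  apply: Rnot_lt_le => h.
  (* If l(w) + l(-w) > 0, this height is strictly below l(w) and its negative strictly below l(-w),
     so both alternatives are impossible. *)
  case: (dich w ((l w - l (- w)%R) / 2)%coqR) => [/lw|[s [hs /lNw]]]; lra.
have lD w w' : D w -> D w' -> l (w + w') = (l w + l w')%coqR.
  move=> Dw Dw'; apply: Rle_antisym; first exact: lsub.
  have e : - w - w' = - (w + w') by rewrite opprD.
  have := lsub _ _ (DN _ Dw) (DN _ Dw').
  rewrite e !lN //; [lra | exact: DD].
have D0 : D 0 by exact: DK K0.
have l0 : l 0 = 0%coqR by have := lN 0 D0; (have -> : - 0 = 0 :> E by rewrite oppr0); lra.
have lZle t w : (0 < t)%coqR -> D w -> (l (RtoC t *: w)%R <= t * l w)%coqR /\ D (RtoC t *: w).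
  move=> t0 Dw; have [lw gw] := lP _ Dw.
  have DZ : D (RtoC t *: w).
    case: Dw => [[r Mr] [s Ms]]; split.
      by exists (t * r)%coqR; exact: coneZ.
    by exists (t * s)%coqR; rewrite -scalerN; exact: coneZ.
  split=> //; have [lZ _] := lP _ DZ.
  suff : (/ t * l (RtoC t *: w)%R <= l w)%coqR.
    move/(Rmult_le_compat_l t _ _ (Rlt_le _ _ t0)).
    by rewrite -Rmult_assoc Rinv_r; lra.
  apply: gw => r Mr; have := lZ _ (coneZ coneM t0 Mr).
  move/(Rmult_le_compat_l (/ t) _ _ (Rlt_le _ _ (Rinv_0_lt_compat _ t0))).
  by rewrite -(Rmult_assoc _ t) Rinv_l; lra.
have lZ t w : (0 < t)%coqR -> D w -> l (RtoC t *: w) = (t * l w)%coqR.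
  move=> t0 Dw; have [h1 DZ] := lZle _ _ t0 Dw.
  apply: Rle_antisym => //.
  have [h2 _] := lZle _ _ t0 (DN _ Dw).
  have e : RtoC t *: (- w) = - (RtoC t *: w) by rewrite scalerN.
  by move: h2; rewrite e !lN //; lra.
exists l; split.
- by move=> w w' r r' /DK Dw /DK Dw'; exact: lD.
- move=> w r t /DK Dw; case: (Rtotal_order t 0) => [t0|[->|t0]].
  + have -> : RtoC t *: w = RtoC (- t) *: - w.
      rewrite scalerN -scaleNr; congr (_ *: _); apply: C_ext => /=; lra.
    by rewrite lZ ?lN //; [lra | lra | exact: DN].
  + by rewrite RtoC0 scale0r l0; lra.
  + exact: lZ.
- by move=> w r Kw; apply: (proj1 (lP _ (DK _ _ Kw))); exact: KM.
Qed.
End HahnBanach.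

(** * Gram-Schmidt and Riesz *)

Section GramSchmidt.
Variables (E : lmodType C) (f : E -> E -> C).
Hypothesis ipf : inner_product f.

Definition orthonormal r (e : 'I_r -> E) :=
  forall p q, f (e p) (e q) = (p == q)%:R.

Definition expands r (e : 'I_r -> E) x := x = \sum_p f x (e p) *: e p.

Lemma inner_expands r (e : 'I_r -> E) x y :
  expands e x -> f x y = \sum_p f x (e p) * f (e p) y.
Proof.
move=> ex; rewrite {1}ex inner_suml //; apply: eq_bigr => p _.
by rewrite (innerZl ipf).
Qed.

Lemma orthonormal_proj r (e : 'I_r -> E) x q : orthonormal e ->
  f (\sum_p f x (e p) *: e p) (e q) = f x (e q).
Proof.
move=> oe; rewrite inner_suml // (bigD1 q) //= big1 => [|p pq].
  by rewrite (innerZl ipf) oe eqxx mulr1 addr0.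
by rewrite (innerZl ipf) oe (negPf pq) mulr0.
Qed.

Lemma normalize x : x <> 0 -> exists2 c : C, f (c *: x) (c *: x) = 1 &
  f x (c *: x) *: (c *: x) = x.
Proof.
move=> x0; have n0 := inner_gt0 ipf x0; set n := cre _ in n0.
have s0 := sqrt_lt_R0 _ n0.
have ss : (sqrt n * sqrt n = n)%coqR by apply: sqrt_sqrt; lra.
have nE : f x x = RtoC (sqrt n * sqrt n) by rewrite ss -inner_real.
have cJ t : Cconj (RtoC t) = RtoC t by apply: C_ext => /=; lra.
exists (RtoC (/ sqrt n)).
  rewrite (innerZl ipf) innerZr // nE cJ -!RtoCM -RtoC1; congr RtoC.
  by field; lra.
rewrite innerZr // scalerA nE cJ -!RtoCM -[RHS]scale1r -RtoC1.
by congr (RtoC _ *: _); field; lra.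
Qed.

(** The vectors may be dependent, whence the separate length r. The last clause says that each e
    lies in the span of v, in the form of an induction principle that can carry membership in a
    subspace over to e. *)
Lemma gram_schmidt k (v : 'I_k -> E) : exists r (e : 'I_r -> E),
  [/\ orthonormal e, forall j, expands e (v j) &
   forall P : E -> Prop, P 0 -> (forall a x y, P x -> P y -> P (a *: x + y)) ->
     (forall j, P (v j)) -> forall p, P (e p)].
Proof.
elim: k v => [|k IH] v.
  by exists 0%N, (fun=> 0); split => [[]|[]|P _ _ _ []].
have [r [e [oe ve spane]]] := IH (fun j => v (widen_ord (leqnSn k) j)).
pose w := \sum_p f (v ord_max) (e p) *: e p.
have we q : f (v ord_max - w) (e q) = 0.
  by rewrite (innerDl ipf) innerNl // orthonormal_proj // subrr.
have ordP (Q : 'I_k.+1 -> Prop) : (forall j, Q (widen_ord (leqnSn k) j)) ->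
    Q ord_max -> forall j, Q j.
  move=> Qw Qm j; case: (unliftP ord_max j) => [i ->|-> //].
  suff -> : lift ord_max i = widen_ord (leqnSn k) i by [].
  by apply: val_inj => /=; rewrite /bump leqNgt ltn_ord.
have spanw (P : E -> Prop) : P 0 -> (forall a x y, P x -> P y -> P (a *: x + y)) ->
    (forall j, P (v j)) -> P (v ord_max - w).
  move=> P0 PD Pv; have Pe p : P (e p) by exact: (spane P P0 PD (fun j => Pv _)).
  have : P (\sum_p f (v ord_max) (e p) *: e p).
    apply: (big_ind P) => // [x y Px Py|p _].
      by rewrite -[x]scale1r; exact: PD.
    by rewrite -[_ *: _]addr0; exact: PD.
  by rewrite addrC -scaleN1r => Pw; exact: PD.
(* A zero residue adds nothing to the family; otherwise its normalisation is appended as last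
   vector. *)
case: (pselect (v ord_max - w = 0)) => [w0|w0].
  exists r, e; split=> //.
    by apply: ordP => //; apply/eqP; rewrite -subr_eq0; apply/eqP.
  by move=> P P0 PD Pv; exact: (spane P P0 PD (fun j => Pv _)).
have [c c1 cw] := normalize w0.
set u := c *: _ in c1 cw.
pose e' (p : 'I_r.+1) := if unlift ord_max p is Some q then e q else u.
have e'l q : e' (lift ord_max q) = e q by rewrite /e' liftK.
have e'm : e' ord_max = u by rewrite /e' unlift_none.
have ue q : f u (e q) = 0 by rewrite (innerZl ipf) we mulr0.
have eu q : f (e q) u = 0 by rewrite -(innerJ ipf) ue rmorph0.
have sumE x : \sum_p f x (e' p) *: e' p = (\sum_p f x (e p) *: e p) + f x u *: u.
  rewrite big_ord_recr /= e'm; congr (_ + _); apply: eq_bigr => p _.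
  suff -> : widen_ord (leqnSn r) p = lift ord_max p by rewrite e'l.
  by apply: val_inj => /=; rewrite /bump leqNgt ltn_ord.
exists r.+1, e'; split.
- move=> p q; case: (unliftP ord_max p) => [i ->|->];
    case: (unliftP ord_max q) => [j ->|->]; rewrite ?e'l ?e'm.
  + by rewrite oe (inj_eq lift_inj).
  + by rewrite eu eq_sym (negPf (neq_lift _ _)).
  + by rewrite ue (negPf (neq_lift _ _)).
  + by rewrite eqxx.
- apply: ordP => [j|]; rewrite /expands sumE.
    suff -> : f (v (widen_ord (leqnSn k) j)) u = 0.
      by rewrite scale0r addr0; exact: ve.
    by rewrite (inner_expands u (ve j)) big1 // => p _; rewrite eu mulr0.
  rewrite -/w; have -> : f (v ord_max) u = f (v ord_max - w) u.
    rewrite (innerDl ipf) innerNl // /w inner_suml // big1 ?oppr0 ?addr0 //.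
    by move=> p _; rewrite (innerZl ipf) eu mulr0.
  by rewrite cw addrC subrK.
- move=> P P0 PD Pv p; case: (unliftP ord_max p) => [i ->|->].
    by rewrite e'l; exact: (spane P P0 PD (fun j => Pv _)).
  by rewrite e'm /u -[c *: _]addr0; exact: (PD _ _ _ (spanw _ P0 PD Pv) P0).
Qed.
End GramSchmidt.

(** Discriminant argument: for c > 0 evaluate at the minimiser -b/c. For c = 0 and b nonzero, t =
    -(a+1)/(2b) would give the value -1. *)
Lemma quadratic_ge0 (a b c : R) : (0 <= c)%coqR ->
  (forall t, 0 <= a + 2 * t * b + t * t * c)%coqR -> (b * b <= a * c)%coqR.
Proof.
move=> [c0|c0] h.
  have := h (- b / c)%coqR.
  have -> : (a + 2 * (- b / c) * b + (- b / c) * (- b / c) * c =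
    / c * (a * c - b * b))%coqR by field; lra.
  move/(Rmult_le_compat_l c _ _ (Rlt_le _ _ c0)).
  by rewrite -Rmult_assoc Rinv_r; lra.
case: (Req_dec b 0) => [->|b0]; first by rewrite -c0; lra.
have := h (- (a + 1) / (2 * b))%coqR; rewrite -c0.
have -> : (a + 2 * (- (a + 1) / (2 * b)) * b +
  (- (a + 1) / (2 * b)) * (- (a + 1) / (2 * b)) * 0 = - 1)%coqR by field.
lra.
Qed.

Section Riesz.
Variable H : CHilbert.
Implicit Types x y z : H.

Definition rip x y := cre (ip x y).

Lemma ripC x y : rip x y = rip y x. Proof. by rewrite /rip -ipJ. Qed.
Lemma ripDl x y z : rip (x + y) z = (rip x z + rip y z)%coqR.
Proof. by rewrite /rip ipDl. Qed.
Lemma ripDr x y z : rip z (x + y) = (rip z x + rip z y)%coqR.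
Proof. by rewrite ripC ripDl !(ripC z). Qed.
Lemma ripZl t x y : rip (RtoC t *: x) y = (t * rip x y)%coqR.
Proof. by rewrite /rip ipZl /=; lra. Qed.
Lemma ripZr t x y : rip x (RtoC t *: y) = (t * rip x y)%coqR.
Proof. by rewrite ripC ripZl ripC. Qed.
Lemma rip_ge0 x : (0 <= rip x x)%coqR. Proof. exact: ip_pos. Qed.

Lemma hnorm_ge0 x : (0 <= hnorm x)%coqR. Proof. exact: sqrt_pos. Qed.
Lemma hnorm_sqr x : (hnorm x * hnorm x = rip x x)%coqR.
Proof. by apply: sqrt_sqrt; exact: rip_ge0. Qed.

Lemma rip_cauchy_schwarz x y : (rip x y * rip x y <= rip x x * rip y y)%coqR.
Proof.
apply: quadratic_ge0 => [|t]; first exact: rip_ge0.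
have := rip_ge0 (x + RtoC t *: y).
by rewrite !(ripDl, ripDr, ripZl, ripZr) (ripC y x); lra.
Qed.

(* The representing vector minimises |x|^2 - 2 F x. *)
Lemma riesz (F : H -> R) (M : R) :
  (forall x y, F (x + y) = (F x + F y)%coqR) ->
  (forall t x, F (RtoC t *: x) = (t * F x)%coqR) ->
  (forall x, (F x <= M * hnorm x)%coqR) ->
  exists y, forall x, F x = rip y x.
Proof.
move=> FD FZ FM; pose J x := (rip x x - 2 * F x)%coqR.
(* Completing the square: |x|^2 - 2M|x| >= -M^2. *)
have Jge x : (- (M * M) <= J x)%coqR.
  have ss := hnorm_sqr x.
  rewrite /J -ss; move: (FM x) (Rle_0_sqr (hnorm x - M)); rewrite /Rsqr; nra.
pose P r := exists x, r = J x; pose m := Rinf P.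
have [mle mge] : (forall r, P r -> (m <= r)%coqR) /\
    (forall b, (forall r, P r -> (b <= r)%coqR) -> (b <= m)%coqR).
  apply: Rinf_glb; first by exists (J 0), 0.
  by exists (- (M * M))%coqR => _ [x ->].
have Jm x : (m <= J x)%coqR by apply: mle; exists x.
have ex n : exists x, (J x < m + / INR n.+1)%coqR.
  have n0 : (0 < / INR n.+1)%coqR by apply: Rinv_0_lt_compat; exact: lt_0_INR (ltP _).
  apply: contrapT => nex; suff : (m + / INR n.+1 <= m)%coqR by lra.
  by apply: mge => _ [x ->]; apply: Rnot_lt_le => h; apply: nex; exists x.
have [u uJ] := choice ex.
have small e : (0 < e)%coqR -> exists N, forall n, (N <= n)%N -> (J (u n) < m + e)%coqR.
  move=> e0; have [N [Ne N0]] := archimed_cor1 e e0.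
  exists N => n Nn; have := uJ n.
  have : (/ INR n.+1 <= / INR N)%coqR.
    apply: Rinv_le_contravar; first exact: lt_0_INR.
    by apply: le_INR; apply/leP; exact: leq_trans Nn (leqnSn n).
  lra.
have sqrt_lt e x : (0 < e)%coqR -> (rip x x < e * e)%coqR -> (sqrt (rip x x) < e)%coqR.
  move=> e0 h; rewrite -(sqrt_square e); last by lra.
  by apply: sqrt_lt_1_alt; split=> //; exact: rip_ge0.
(* Parallelogram law at the midpoint: |x-y|^2 = 2J(x) + 2J(y) - 4J((x+y)/2). Hence minimising
   sequences are Cauchy. *)
have par x y : (rip (x - y)%R (x - y)%R <= 2 * (J x + J y - 2 * m))%coqR.
  have := Jm (RtoC (/ 2) *: (x + y)).
  rewrite /J FZ FD opp_scal !(ripDl, ripDr, ripZl, ripZr) (ripC y x); lra.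
have [eps eps0|y yl] := h_complete (c := H) (u := u).
  have [N hN] := small (eps * eps / 4)%coqR ltac:(nra).
  exists N => p q Np Nq; apply: (sqrt_lt eps (u p - u q)) => //.
  by have := par (u p) (u q); have := hN _ Np; have := hN _ Nq; lra.
exists y => x.
(* Perturbing a near-minimiser u_n by t x bounds (<u_n,x> - F x)^2 through the discriminant, and
   Cauchy-Schwarz bounds <u_n - y,x>^2. Each is at most (e/4)|x|^2, and (a-b)^2 <= 2a^2 + 2b^2. *)
have key e : (0 < e)%coqR ->
    ((F x - rip y x) * (F x - rip y x) <= e * rip x x)%coqR.
  move=> e0.
  have [N hN] := small (e / 4)%coqR ltac:(lra).
  have [N' hN'] := yl (sqrt (e / 4)) (sqrt_lt_R0 (e / 4) ltac:(lra)).
  pose n := maxn N N'.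
  have h1 := hN n (leq_maxl _ _).
  have h2 : (rip (u n - y)%R (u n - y)%R < e / 4)%coqR.
    exact: (sqrt_lt_0_alt _ _ (hN' n (leq_maxr _ _))).
  have h3 := @quadratic_ge0 (e / 4) (rip (u n) x - F x) (rip x x) (rip_ge0 x).
  have {}h3 : ((rip (u n) x - F x) * (rip (u n) x - F x) <= e / 4 * rip x x)%coqR.
    apply: h3 => t; have := Jm (u n + RtoC t *: x).
    move: h1.
    rewrite /J FD FZ !(ripDl, ripDr, ripZl, ripZr) (ripC x (u n)); lra.
  have e1 : rip (u n - y) x = (rip (u n) x - rip y x)%coqR.
    by rewrite opp_scal ripDl ripZl; lra.
  have := rip_cauchy_schwarz (u n - y) x; rewrite e1 => h4.
  have := Rmult_le_compat_r _ _ _ (rip_ge0 x) (Rlt_le _ _ h2).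
  have := Rle_0_sqr (rip (u n) x - F x + (rip (u n) x - rip y x)).
  rewrite /Rsqr; lra.
have xx := rip_ge0 x.
have d0 : ((F x - rip y x) * (F x - rip y x) <= 0)%coqR.
  apply: Rnot_lt_le => d0; set d := (_ * _)%coqR in key d0.
  (* This e makes e |x|^2 strictly smaller than d. *)
  have e0 : (0 < d / (2 * (rip x x + 1)))%coqR by apply: Rdiv_lt_0_compat; lra.
  have := key _ e0.
  have : (d / (2 * (rip x x + 1)) * (2 * (rip x x + 1)) = d)%coqR by field; lra.
  move: (d / _)%coqR e0 => z *; nra.
have := Rle_0_sqr (F x - rip y x); rewrite {1}/Rsqr => h.
by apply: Rminus_diag_uniq; apply: Rsqr_0_uniq; rewrite /Rsqr; lra.
Qed.
End Riesz.

Section OrthonormalSums.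
Variables (E : lmodType C) (f : E -> E -> C).
Hypothesis ipf : inner_product f.

Lemma orthonormal_inner r (e : 'I_r -> E) (a b : 'I_r -> C) : orthonormal f e ->
  f (\sum_p a p *: e p) (\sum_p b p *: e p) = \sum_p a p * Cconj (b p).
Proof.
move=> oe; rewrite inner_suml //; apply: eq_bigr => p _.
rewrite (innerZl ipf) inner_sumr // (bigD1 p) //= big1 => [|q qp].
  by rewrite innerZr // oe eqxx mulr1 addr0.
by rewrite innerZr // oe eq_sym (negPf qp) mulr0.
Qed.
End OrthonormalSums.

(** * Compression by isometries *)

(** [C^o] is [C] as a module over itself, so the functions into it form an [lmodType] and
    [gram_schmidt] applies to columns of matrices. *)
Definition cip n (x y : 'I_n -> C^o) : C := \sum_i x i * Cconj (y i).

Lemma Cabs2E a : RtoC (Cabs2 a) = a * Cconj a.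
Proof. by apply: C_ext => /=; rewrite /Cabs2; lra. Qed.

Lemma Cabs2_ge0 a : (0 <= Cabs2 a)%coqR.
Proof. by rewrite /Cabs2; nra. Qed.

Lemma rsum_ge0 n (F : 'I_n -> R) : (forall i, (0 <= F i)%coqR) -> (0 <= rsum F)%coqR.
Proof.
move=> F0; rewrite /rsum bsumE; by apply: (big_ind (Rle 0)) => //; [lra | move=> x y; lra].
Qed.

Lemma rsum_ge n (F : 'I_n -> R) i : (forall i, (0 <= F i)%coqR) -> (F i <= rsum F)%coqR.
Proof.
move=> F0; rewrite rsumE (bigD1 i) //=.
rewrite cre_sum -[X in (X <= _)%coqR]Rplus_0_r; apply: Rplus_le_compat_l.
by apply: (big_ind (Rle 0)) => [|x y|j _]; [lra | lra | exact: F0].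
Qed.

Lemma cipE n (x : 'I_n -> C^o) : cip x x = RtoC (rsum (fun i => Cabs2 (x i))).
Proof. by rewrite RtoC_rsum; apply: eq_bigr => i _; rewrite Cabs2E. Qed.

Lemma cip_inner n : inner_product (@cip n).
Proof.
split=> [x y z|a x y|x y|x|x].
- by rewrite -big_split; apply: eq_bigr => i _; exact: mulrDl.
- by rewrite /cip mulr_sumr; apply: eq_bigr => i _; rewrite mulrA.
- by rewrite rmorph_sum; apply: eq_bigr => i _; rewrite rmorphM /= CconjK mulrC.
- by rewrite cipE; apply: rsum_ge0 => i; exact: Cabs2_ge0.
- rewrite cipE => -[x0]; apply: funext => i.
  have : (Cabs2 (x i) <= 0)%coqR.
    by rewrite -x0; apply: (rsum_ge (F := fun i => Cabs2 (x i))) => j; exact: Cabs2_ge0.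
  by rewrite /Cabs2 => h; apply: C_ext => /=; nra.
Qed.

(** Orthonormal columns preserve [cvnorm], so the supremum runs over norms of vectors in the unit
    ball. It is 0 rather than 1 when r = 0, which explains the inequality. *)
Lemma mxnorm_isometry n r (u : 'I_r -> 'I_n -> C^o) : orthonormal (@cip n) u ->
  (0 <= mxnorm (fun i p => u p i) <= 1)%coqR.
Proof.
move=> ou; pose X : mx C n r := fun i p => u p i.
have norm_eq v : cvnorm (cmxmulv X v) = cvnorm v.
  congr sqrt; suff [] : RtoC (rsum (fun i => Cabs2 (cmxmulv X v i))) =
    RtoC (rsum (fun i => Cabs2 (v i))) by [].
  rewrite -(cipE (cmxmulv X v)).
  have -> : cmxmulv X v = \sum_p v p *: u p.
    apply: funext => i; rewrite fct_sumE /cmxmulv csumE.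
    by apply: eq_bigr => p _; exact: mulrC.
  rewrite orthonormal_inner //; last exact: cip_inner.
  by rewrite RtoC_rsum; apply: eq_bigr => p _; rewrite Cabs2E.
pose P (s : R) := exists v, (cvnorm v <= 1)%coqR /\ s = cvnorm (cmxmulv X v).
have P0 : P 0%coqR.
  exists (fun=> C0); rewrite norm_eq /cvnorm.
  have -> : rsum (fun i : 'I_r => Cabs2 C0) = 0%coqR.
    rewrite rsumE big1 // => i _; apply: C_ext => /=; rewrite /Cabs2 /=; lra.
  by rewrite sqrt_0; split=> //; lra.
have P1 s : P s -> (s <= 1)%coqR by case=> v []; rewrite norm_eq => ? ->.
have [||ub lub] := @Rsup_lub P; [by exists 1%coqR | by exists 0%coqR |].
by split; [exact: ub | exact: lub].
Qed.

Lemma exchange_big4 (M : nmodType) (I J P Q : finType) (F : P -> Q -> I -> J -> M) :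
  \sum_p \sum_q \sum_i \sum_j F p q i j = \sum_i \sum_j \sum_p \sum_q F p q i j.
Proof.
under eq_bigr do rewrite exchange_big /=.
rewrite exchange_big /=; apply: eq_bigr => i _.
under eq_bigr do rewrite exchange_big /=.
by rewrite exchange_big.
Qed.

(** One shape for two objects: with [tensor] it is the element A.xi of W, with [opform phi] the
    quadratic form of the operator matrix phi(A) at xi. *)
Definition qform (V : Type) (H : Type) (M : nmodType) (G : V -> H -> H -> M) n
    (A : mx V n n) (xi : 'I_n -> H) : M :=
  \sum_i \sum_j G (A i j) (xi j) (xi i).

(** The element u^* A v of V. Its values on columns are the entries of a congruence, so a change of
    columns can be made one slot at a time. *)
Definition sesq (V : StarVS) n (A : mx V n n) (u v : 'I_n -> C^o) : V :=
  \sum_i \sum_j (Cconj (u i) * v j) *: A i j.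

Section Sesq.
Variables (V : StarVS) (n : nat) (A : mx V n n).
Implicit Types u v w : 'I_n -> C^o.

Lemma mx_congE k (X : mx C n k) p q :
  mx_cong X A p q = sesq A (fun i => X i p) (fun i => X i q).
Proof. by rewrite /mx_cong vsumE; apply: eq_bigr => i _; rewrite vsumE. Qed.

Lemma sesqDl a u v w : sesq A (a *: u + v) w = Cconj a *: sesq A u w + sesq A v w.
Proof.
rewrite scaler_sumr -big_split; apply: eq_bigr => i _ /=.
rewrite scaler_sumr -big_split; apply: eq_bigr => j _ /=.
by rewrite scalerA -scalerDl rmorphD rmorphM mulrDl mulrA.
Qed.

Lemma sesqDr a u v w : sesq A w (a *: u + v) = a *: sesq A w u + sesq A w v.
Proof.
rewrite scaler_sumr -big_split; apply: eq_bigr => i _ /=.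
rewrite scaler_sumr -big_split; apply: eq_bigr => j _ /=.
by rewrite scalerA -scalerDl mulrDr mulrCA.
Qed.

Lemma sesq0l w : sesq A 0 w = 0.
Proof.
rewrite /sesq big1 // => i _; rewrite big1 // => j _.
by rewrite (_ : (0 : 'I_n -> C^o) i = 0) // rmorph0 mul0r scale0r.
Qed.

Lemma sesq0r w : sesq A w 0 = 0.
Proof.
rewrite /sesq big1 // => i _; rewrite big1 // => j _.
by rewrite (_ : (0 : 'I_n -> C^o) j = 0) // mulr0 scale0r.
Qed.

Lemma sesq_suml k (a : 'I_k -> C) (u : 'I_k -> 'I_n -> C^o) w :
  sesq A (\sum_p a p *: u p) w = \sum_p Cconj (a p) *: sesq A (u p) w.
Proof.
elim/big_rec2: _ => [|p y x _ <-]; first exact: sesq0l.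
exact: sesqDl.
Qed.

Lemma sesq_sumr k (a : 'I_k -> C) (u : 'I_k -> 'I_n -> C^o) w :
  sesq A w (\sum_p a p *: u p) = \sum_p a p *: sesq A w (u p).
Proof.
elim/big_rec2: _ => [|p y x _ <-]; first exact: sesq0r.
exact: sesqDr.
Qed.

Lemma sesq_star u v : is_sa A -> sesq A u v = svstar (sesq A v u).
Proof.
move=> saA; rewrite /sesq [in RHS]exchange_big raddf_sum; apply: eq_bigr => i _.
rewrite raddf_sum; apply: eq_bigr => j _.
by rewrite /= starZ rmorphM /= CconjK mulrC -saA.
Qed.
End Sesq.

Lemma mx_cong_sa (V : StarVS) n k (X : mx C n k) (A : mx V n n) :
  is_sa A -> is_sa (mx_cong X A).
Proof. by move=> saA p q; rewrite !mx_congE; exact: sesq_star. Qed.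

(* Factoring [X = U R] with [U] an isometry whose columns span those of [X]. *)
Lemma mx_cong_isometry (V : StarVS) (S : V -> Prop) n k (X : mx C n k)
    (A : mx V n n) :
  S 0 -> (forall a x y, S x -> S y -> S (a *: x + y)) ->
  (forall p q, S (mx_cong X A p q)) ->
  exists r (U : mx C n r) (Y : mx C r k),
  [/\ (0 <= mxnorm U <= 1)%coqR, forall s t, S (mx_cong U A s t),
      mx_cong X A = mx_cong Y (mx_cong U A) &
      forall p, \sum_i X i p * Cconj (X i p) = \sum_s Y s p * Cconj (Y s p)].
Proof.
move=> S0 SD SX; pose x p : 'I_n -> C^o := fun i => X i p.
have [r [u [ou xu spanu]]] := gram_schmidt (cip_inner n) x.
exists r, (fun i s => u s i), (fun s p => cip (x p) (u s)).
split.
- exact: mxnorm_isometry.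
(* Membership in [S] passes from the columns x to the u in the left slot first, then in the right
   slot. *)
- have Sux s q : S (sesq A (u s) (x q)).
    apply: (spanu (fun v => S (sesq A v (x q)))) => [|a y z Sy Sz|p].
    + by rewrite sesq0l.
    + by rewrite sesqDl; exact: SD.
    + by rewrite -mx_congE.
  move=> s t; rewrite mx_congE.
  apply: (spanu (fun v => S (sesq A (u s) v))) => [|a y z Sy Sz|q //].
  + by rewrite sesq0r.
  + by rewrite sesqDr; exact: SD.
- apply: funext => p; apply: funext => q.
  rewrite !mx_congE -/(x p) -/(x q) {1}(xu p) {1}(xu q) sesq_suml.
  apply: eq_bigr => s _; rewrite sesq_sumr scaler_sumr; apply: eq_bigr => t _.
  by rewrite scalerA mx_congE.
- move=> p; rewrite -/(cip (x p) (x p)) (inner_expands (cip_inner n) _ (xu p)).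
  by apply: eq_bigr => s _; rewrite (innerJ (cip_inner n)).
Qed.

(** * Operator gauges *)

Definition sqnorm (H : CHilbert) n (xi : 'I_n -> H) : R := rsum (fun i => rip (xi i) (xi i)).

Lemma sqnormE (H : CHilbert) n (xi : 'I_n -> H) :
  RtoC (sqnorm xi) = \sum_i ip (xi i) (xi i).
Proof.
rewrite RtoC_rsum; apply: eq_bigr => i _.
by rewrite [RHS](inner_real (ip_inner H)).
Qed.

Lemma sqnorm_ge0 (H : CHilbert) n (xi : 'I_n -> H) : (0 <= sqnorm xi)%coqR.
Proof. by apply: rsum_ge0 => i; exact: rip_ge0. Qed.

Definition opform (V : Type) (H : CHilbert) (phi : V -> H -> H) x xi eta : C :=
  ip (phi x xi) eta.

Lemma op_le_tIE (V : Type) (H : CHilbert) (phi : V -> H -> H) n (A : mx V n n) t :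
  op_le_tI (fun i j => phi (A i j)) t <->
  forall xi, (cre (qform (opform phi) A xi) <= t * sqnorm xi)%coqR.
Proof.
suff e xi : csum (fun i => csum (fun j => ip (phi (A i j) (xi j)) (xi i))) =
    qform (opform phi) A xi.
  by split=> h xi; have := h xi; rewrite e.
by rewrite csumE; apply: eq_bigr => i _; rewrite csumE.
Qed.

Lemma rip_le_hnorm (H : CHilbert) (x y : H) : (rip x y <= hnorm x * hnorm y)%coqR.
Proof.
have h1 := hnorm_ge0 x.
have h2 := hnorm_ge0 y.
have s1 := hnorm_sqr x.
have s2 := hnorm_sqr y.
have cs := rip_cauchy_schwarz x y; rewrite -s1 -s2 in cs.
have h3 := Rmult_le_pos _ _ h1 h2.
apply: Rnot_lt_le => h; nra.
Qed.

Lemma big_bounded (T I : Type) (s : seq I) (F : I -> T -> R) (g : T -> R) :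
  (forall x, 0 <= g x)%coqR ->
  (forall i, exists M, forall x, F i x <= M * g x)%coqR ->
  exists M, forall x, (\big[Rplus/0%coqR]_(i <- s) F i x <= M * g x)%coqR.
Proof.
move=> g0 hF; elim: s => [|i s [M hM]].
  by exists 0%coqR => x; rewrite big_nil; lra.
have [N hN] := hF i; exists (N + M)%coqR => x.
by rewrite big_cons; have := hN x; have := hM x; lra.
Qed.

(** Shows that the set defining [d_BH] is nonempty, so that its infimum is meaningful. *)
Lemma op_bounded (V : Type) (H : CHilbert) (phi : V -> H -> H) n (A : mx V n n) :
  (forall i j, bounded_op (phi (A i j))) ->
  exists t, (0 < t)%coqR /\ op_le_tI (fun i j => phi (A i j)) t.
Proof.
move=> bA; pose F i (xi : 'I_n -> H) := \big[Rplus/0%coqR]_j rip (phi (A i j) (xi j)) (xi i).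
have [i|M hM] := big_bounded (index_enum 'I_n) (F := F) (@sqnorm_ge0 H n).
  apply: big_bounded => [xi|j]; first exact: sqnorm_ge0.
  (* The constant in [bounded_op] carries no sign; it is made nonnegative before inequalities are
     multiplied. *)
  have [_ [_ [M hM]]] := bA i j; exists (Rmax M 0)%coqR => xi.
  have := rip_le_hnorm (phi (A i j) (xi j)) (xi i).
  have := hM (xi j).
  have h1 := hnorm_ge0 (xi j).
  have h2 := hnorm_ge0 (xi i).
  have s1 := hnorm_sqr (xi j).
  have s2 := hnorm_sqr (xi i).
  have n1 : (rip (xi j) (xi j) <= sqnorm xi)%coqR.
    by apply: (rsum_ge (F := fun i => rip (xi i) (xi i))) => k; exact: rip_ge0.
  have n2 : (rip (xi i) (xi i) <= sqnorm xi)%coqR.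
    by apply: (rsum_ge (F := fun i => rip (xi i) (xi i))) => k; exact: rip_ge0.
  have m0 := Rmax_r M 0; have mM := Rmax_l M 0.
  move: (Rmax M 0) m0 mM => N m0 mM k1 k2.
  have k3 : (hnorm (phi (A i j) (xi j)) <= N * hnorm (xi j))%coqR by nra.
  have k4 : (hnorm (xi j) * hnorm (xi i) <= sqnorm xi)%coqR.
    by have := Rle_0_sqr (hnorm (xi j) - hnorm (xi i)); rewrite /Rsqr; lra.
  have := Rmult_le_compat_r _ _ _ h2 k3.
  have := Rmult_le_compat_l _ _ _ m0 k4.
  by lra.
exists (Rmax M 1); split; first by have := Rmax_r M 1; lra.
apply/op_le_tIE => xi; apply: Rle_trans (_ : M * sqnorm xi <= _)%coqR.
  apply: Rle_trans (hM xi); rewrite cre_sum; apply: Req_le.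
  by apply: eq_bigr => i _; rewrite cre_sum.
by apply: Rmult_le_compat_r; [exact: sqnorm_ge0 | exact: Rmax_l].
Qed.

(** Were the infimum above c, the midpoint between the two would be an admissible t below it.
    Testing only t > c lets strict bounds nu A < t be used. *)
Lemma d_BH_le (V : Type) (H : CHilbert) (phi : V -> H -> H) n (A : mx V n n) c :
  (forall t, (c < t)%coqR -> op_le_tI (fun i j => phi (A i j)) t) -> (0 <= c)%coqR ->
  (d_BH (fun i j => phi (A i j)) <= c)%coqR.
Proof.
move=> h c0; apply: Rnot_lt_le => lt_c.
set d := d_BH _ in lt_c.
pose P t := (0 < t)%coqR /\ op_le_tI (fun i j => phi (A i j)) t.
have Pt t : (c < t)%coqR -> P t by move=> ct; split; [lra | exact: h].
have [||lb _] := @Rinf_glb P.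
- by exists (c + 1)%coqR; apply: Pt; lra.
- by exists 0%coqR => t [t0 _]; lra.
have /Pt/lb : (c < (c + d) / 2)%coqR by lra.
by rewrite -[Rinf P]/d; lra.
Qed.

Lemma d_BH_ge (V : Type) (H : CHilbert) (phi : V -> H -> H) n (A : mx V n n) c xi :
  (forall i j, bounded_op (phi (A i j))) ->
  (d_BH (fun i j => phi (A i j)) <= c)%coqR ->
  (cre (qform (opform phi) A xi) <= c * sqnorm xi)%coqR.
Proof.
move=> /op_bounded [t0 ht0] dc.
have [||_ glb] := @Rinf_glb (fun t => 0 < t /\ op_le_tI (fun i j => phi (A i j)) t)%coqR.
- by exists t0.
- by exists 0%coqR => t [t1 _]; lra.
(* If |xi| = 0, the admissible t0 already gives q <= 0. Otherwise q / |xi|^2 is a lower bound of all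
   admissible t, hence at most the infimum. *)
set q := cre _; have n0 := sqnorm_ge0 xi; case: n0 => n0; last first.
  by case: ht0 => _ /op_le_tIE /(_ xi); rewrite -/q -n0; lra.
suff : (q / sqnorm xi <= d_BH (fun i j => phi (A i j)))%coqR.
  move=> h; have {}h : (q / sqnorm xi <= c)%coqR by lra.
  have := Rmult_le_compat_r _ _ _ (Rlt_le _ _ n0) h.
  by rewrite /Rdiv Rmult_assoc Rinv_l; lra.
apply: glb => t [_ /op_le_tIE /(_ xi)]; rewrite -/q => h.
apply: (Rmult_le_reg_r (sqnorm xi)) => //.
by rewrite /Rdiv Rmult_assoc Rinv_l; lra.
Qed.

(** * The cone and its extension *)

Definition catf T n m (f : 'I_n -> T) (g : 'I_m -> T) : 'I_(n + m) -> T :=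
  fun i => match fintype.split i with inl a => f a | inr b => g b end.

Lemma catfl T n m (f : 'I_n -> T) (g : 'I_m -> T) i : catf f g (lshift m i) = f i.
Proof. by rewrite /catf (unsplitK (inl i)). Qed.
Lemma catfr T n m (f : 'I_n -> T) (g : 'I_m -> T) i : catf f g (rshift n i) = g i.
Proof. by rewrite /catf (unsplitK (inr i)). Qed.

(* The elementary tensor [x (x) xi (x) conj eta], represented by the [V]-valued form
   it induces on [H]; this makes [V (x) H (x) conj H] a space of functions. *)
Definition tensor (V : StarVS) (H : CHilbert) (x : V) (xi eta : H) : H -> H -> V :=
  fun a b => (ip xi a * ip b eta) *: x.

Section Extension.
Variables (V : LinfMOS) (S : V -> Prop) (H : CHilbert) (phi : V -> H -> H).
Hypotheses (subS : sa_subspace S) (lphi : op_linear_on S phi) (cphi : cgc_on S phi).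

Let S0 : S 0. Proof. by case: subS. Qed.
Let SD x y : S x -> S y -> S (x + y). Proof. by case: subS => _ [h _]; exact: h. Qed.
Let SZ a x : S x -> S (a *: x). Proof. by case: subS => _ [_ [h _]]; exact: h. Qed.

Lemma opformDl x y xi eta : S x -> S y ->
  opform phi (x + y) xi eta = opform phi x xi eta + opform phi y xi eta.
Proof.
by case: lphi => _ [h _] Sx Sy; rewrite -ipDl; congr ip; exact: h.
Qed.

Lemma opformZl a x xi eta : S x -> opform phi (a *: x) xi eta = a * opform phi x xi eta.
Proof.
by case: lphi => _ [_ h] Sx; rewrite -ipZl; congr ip; exact: h.
Qed.

Lemma opform0 xi eta : opform phi 0 xi eta = 0.
Proof. by rewrite -(scale0r (0 : V)) opformZl // mul0r. Qed.

(** Additivity of [phi] is available only on [S], so the induction must carry membership of the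
    partial sums. *)
Lemma opform_sum (I : Type) (s : seq I) (F : I -> V) xi eta : (forall i, S (F i)) ->
  S (\sum_(i <- s) F i) /\
  opform phi (\sum_(i <- s) F i) xi eta = \sum_(i <- s) opform phi (F i) xi eta.
Proof.
move=> SF; elim/big_rec2: _ => [|i y x _ [Sx <-]]; first by split; [|exact: opform0].
by split; [exact: SD | exact: opformDl].
Qed.

Lemma opform_mid x k (a : 'I_k -> C) (e : 'I_k -> H) eta : S x ->
  opform phi x (\sum_p a p *: e p) eta = \sum_p a p * opform phi x (e p) eta.
Proof.
case: lphi => bphi _ Sx; have [hD [hZ _]] := bphi x Sx.
elim/big_rec2: _ => [|p y xi _ <-].
  rewrite -(scale0r (0 : H)) /opform (_ : phi x _ = 0 *: phi x 0); last exact: hZ.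
  by rewrite ipZl mul0r.
rewrite /opform -ipZl -ipDl; congr ip.
by rewrite -[a p *: phi x _]/(hscal _ _) -hZ; exact: hD.
Qed.

Lemma opform_right x k (a : 'I_k -> C) (e : 'I_k -> H) xi :
  opform phi x xi (\sum_p a p *: e p) = \sum_p Cconj (a p) * opform phi x xi (e p).
Proof.
rewrite /opform (inner_sumr (ip_inner H)); apply: eq_bigr => p _.
by rewrite (innerZr (ip_inner H)).
Qed.

(** A congruence moves from the matrix to the vectors, as in <Y^* B Y e, e> = <B Y e, Y e>; both
    sides expand to the same fourfold sum. *)
Lemma qform_cong n k (B : mx V n n) (Y : mx C n k) (e : 'I_k -> H) :
  (forall i j, S (B i j)) ->
  qform (opform phi) (mx_cong Y B) e =
  qform (opform phi) B (fun i => \sum_p Y i p *: e p).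
Proof.
move=> SB; rewrite /qform.
transitivity (\sum_p \sum_q \sum_i \sum_j
    (Cconj (Y i p) * Y j q) * opform phi (B i j) (e q) (e p)).
  apply: eq_bigr => p _; apply: eq_bigr => q _; rewrite mx_congE /sesq.
  have Sij i j : S ((Cconj (Y i p) * Y j q) *: B i j) by exact: SZ.
  have Si i := opform_sum (index_enum _) (e q) (e p) (Sij i).
  rewrite (opform_sum _ _ _ (fun i => (Si i).1)).2; apply: eq_bigr => i _.
  by rewrite (Si i).2; apply: eq_bigr => j _; rewrite opformZl.
rewrite exchange_big4; apply: eq_bigr => i _; apply: eq_bigr => j _.
rewrite opform_right; apply: eq_bigr => p _.
by rewrite opform_mid // mulr_sumr; apply: eq_bigr => q _; rewrite mulrA.
Qed.

Lemma contractive_on n (A : mx V n n) xi : (forall i j, S (A i j)) -> is_sa A ->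
  (nu A <= 1)%coqR -> (cre (qform (opform phi) A xi) <= sqnorm xi)%coqR.
Proof.
move=> SA saA A1; rewrite -[sqnorm xi]Rmult_1_l.
case: lphi => bphi _; case: cphi => _ cg.
by apply: d_BH_ge => [i j|]; [exact: bphi | apply: Rle_trans A1; exact: cg].
Qed.

(** Evaluating a tensor at pairs of test vectors reads off a congruence of A by coefficients, which
    turns identities in W into matrix identities over V. *)
Lemma qform_tensorE n (A : mx V n n) xi r (e : 'I_r -> H) p q :
  qform (@tensor V H) A xi (e q) (e p) =
  mx_cong (fun i p => ip (xi i) (e p)) A p q.
Proof.
rewrite mx_congE /qform !fct_sumE; apply: eq_bigr => i _.
rewrite !fct_sumE; apply: eq_bigr => j _.
by rewrite /tensor mulrC ipJ.
Qed.

(* Expand all vectors in a common orthonormal family [e]: the hypothesis then says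
   [X^* A X = - Y^* B Y], whose entries lie in [S], and [X = U R] reduces the bound
   to the contractivity of [phi] at [U^* A U]. *)
Lemma tensor_positivity n m (A : mx V n n) (xi : 'I_n -> H) (B : mx V m m) (eta : 'I_m -> H) :
  is_sa A -> (nu A <= 1)%coqR -> (forall i j, S (B i j)) ->
  qform (@tensor V H) A xi + qform (@tensor V H) B eta = 0 ->
  (0 <= sqnorm xi + cre (qform (opform phi) B eta))%coqR.
Proof.
move=> saA A1 SB AB0.
have [r [e [oe ee _]]] := gram_schmidt (ip_inner H) (catf xi eta).
have exi i : expands (@ip H) e (xi i) by have := ee (lshift m i); rewrite catfl.
have eeta i : expands (@ip H) e (eta i) by have := ee (rshift n i); rewrite catfr.
pose X : mx C n r := fun i p => ip (xi i) (e p).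
pose Y : mx C m r := fun i p => ip (eta i) (e p).
have XY p q : mx_cong X A p q = - mx_cong Y B p q.
  apply/eqP; rewrite -addr_eq0 -!qform_tensorE; apply/eqP.
  exact: (congr1 (fun F => F (e q) (e p)) AB0).
have SY p q : S (mx_cong Y B p q).
  rewrite mx_congE.
  have Sij i j : S ((Cconj (Y i p) * Y j q) *: B i j) by exact: SZ.
  have Si i := (opform_sum (index_enum _) 0 0 (Sij i)).1.
  exact: (opform_sum (index_enum _) 0 0 Si).1.
have SX p q : S (mx_cong X A p q) by rewrite XY -scaleN1r; exact: SZ.
have SP a x y : S x -> S y -> S (a *: x + y) by move=> Sx Sy; apply: SD => //; exact: SZ.
have [k [U [T [U1 SU XT nT]]]] := mx_cong_isometry S0 SP SX.
pose zeta s := \sum_p T s p *: e p.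
(* Through the vectors e: phi(B) at eta is phi(Y^* B Y) at e, the negative of phi(X^* A X) at e.
   Since X^* A X is the congruence of U^* A U by T, this moves to zeta. *)
have -> : qform (opform phi) B eta = - qform (opform phi) (mx_cong U A) zeta.
  rewrite -qform_cong // -XT (_ : eta = fun i => \sum_p Y i p *: e p); last first.
    by apply: funext => i; exact: eeta.
  rewrite -qform_cong // /qform -sumrN; apply: eq_bigr => p _.
  rewrite -sumrN; apply: eq_bigr => q _.
  by rewrite XY -scaleN1r opformZl // mulN1r opprK.
(* By Parseval both sides are sums of squared moduli of entries, of X and of T, and [nT] matches
   them column by column. *)
have -> : sqnorm xi = sqnorm zeta.
  suff [] : RtoC (sqnorm xi) = RtoC (sqnorm zeta) by [].
  rewrite !sqnormE.
  transitivity (\sum_i \sum_p X i p * Cconj (X i p)).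
    apply: eq_bigr => i _; rewrite (inner_expands (ip_inner H) _ (exi i)).
    by apply: eq_bigr => p _; rewrite ipJ.
  rewrite exchange_big /=; under eq_bigr do rewrite nT.
  rewrite exchange_big /=; apply: eq_bigr => s _.
  by rewrite (orthonormal_inner (ip_inner H) _ _ oe).
have U2 : (nu (mx_cong U A) <= 1)%coqR.
  apply: Rle_trans (nu_cong _ saA) _; have := nu_nonneg saA.
  by move: U1; move: (mxnorm U) (nu A) A1 => u a; nra.
have := contractive_on zeta SU (mx_cong_sa U saA) U2.
by rewrite /=; lra.
Qed.
End Extension.

(** * Direct sums of matrices and linearity of tensors *)

Lemma qform_map (V V' T T' : Type) (M M' : nmodType) (G : V -> T -> T -> M)
    (G' : V' -> T' -> T' -> M') (h : M -> M') n (A : mx V n n) (A' : mx V' n n) xi xi' :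
  h 0 = 0 -> (forall x y, h (x + y) = h x + h y) ->
  (forall i j, G' (A' i j) (xi' j) (xi' i) = h (G (A i j) (xi j) (xi i))) ->
  qform G' A' xi' = h (qform G A xi).
Proof.
move=> h0 hD e; rewrite (big_morph h hD h0); apply: eq_bigr => i _.
by rewrite (big_morph h hD h0); apply: eq_bigr => j _.
Qed.

Lemma dsumE (V : StarVS) n m (A : mx V n n) (B : mx V m m) :
  [/\ forall i j, dsum A B (lshift m i) (lshift m j) = A i j,
      forall i j, dsum A B (rshift n i) (rshift n j) = B i j,
      forall i j, dsum A B (lshift m i) (rshift n j) = 0 &
      forall i j, dsum A B (rshift n i) (lshift m j) = 0].
Proof.
by split=> i j; rewrite /dsum ?(unsplitK (inl _)) ?(unsplitK (inr _)).
Qed.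

Lemma ord_addP n m (P : 'I_(n + m) -> Prop) :
  (forall i, P (lshift m i)) -> (forall i, P (rshift n i)) -> forall i, P i.
Proof. by move=> Pl Pr i; case: (split_ordP i) => j ->. Qed.

(** The off-diagonal blocks contribute nothing, so a sum of two elements A.xi is again of this form;
    closure of the cone under addition rests on it. *)
Lemma qform_dsum (V : StarVS) (T : Type) (M : nmodType) (G : V -> T -> T -> M)
    n m (A : mx V n n) (B : mx V m m) xi eta :
  (forall u v, G 0 u v = 0) ->
  qform G (dsum A B) (catf xi eta) = qform G A xi + qform G B eta.
Proof.
move=> G0; have [dll drr dlr drl] := dsumE A B.
rewrite /qform big_split_ord /=; congr (_ + _); apply: eq_bigr => i _;
  rewrite big_split_ord /=.
  rewrite [X in _ + X]big1 ?addr0 => [|j _]; last by rewrite dlr.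
  by apply: eq_bigr => j _; rewrite dll !catfl.
rewrite [X in X + _]big1 ?add0r => [|j _]; last by rewrite drl.
by apply: eq_bigr => j _; rewrite drr !catfr.
Qed.

Lemma dsum_sa (V : StarVS) n m (A : mx V n n) (B : mx V m m) :
  is_sa A -> is_sa B -> is_sa (dsum A B).
Proof.
move=> saA saB; have [dll drr dlr drl] := dsumE A B.
have star0 : svstar 0 = 0 :> V by exact: raddf0.
by apply: ord_addP => i; apply: ord_addP => j;
  rewrite ?dll ?drr ?dlr ?drl ?star0.
Qed.

Lemma dsum_all (V : StarVS) (S : V -> Prop) n m (A : mx V n n) (B : mx V m m) : S 0 ->
  (forall i j, S (A i j)) -> (forall i j, S (B i j)) -> forall i j, S (dsum A B i j).
Proof.
move=> S0 SA SB; have [dll drr dlr drl] := dsumE A B.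
by apply: ord_addP => i; apply: ord_addP => j; rewrite ?dll ?drr ?dlr ?drl.
Qed.

Lemma sqnorm_cat (H : CHilbert) n m (xi : 'I_n -> H) (eta : 'I_m -> H) :
  sqnorm (catf xi eta) = (sqnorm xi + sqnorm eta)%coqR.
Proof.
rewrite /sqnorm rsum_split /rsum !bsumE.
by congr Rplus; apply: eq_bigr => i _; rewrite ?catfl ?catfr.
Qed.

Lemma RtoC_J t : Cconj (RtoC t) = RtoC t.
Proof. by apply: C_ext => /=; lra. Qed.

Lemma sqnormZ (H : CHilbert) n (xi : 'I_n -> H) t :
  sqnorm (fun i => RtoC t *: xi i) = (t * t * sqnorm xi)%coqR.
Proof.
suff [] : RtoC (sqnorm (fun i => RtoC t *: xi i)) = RtoC (t * t * sqnorm xi) by [].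
rewrite !RtoCM !sqnormE mulr_sumr; apply: eq_bigr => i _.
by rewrite ipZl (innerZr (ip_inner H)) RtoC_J mulrA.
Qed.

Section Tensor.
Variables (V : StarVS) (H : CHilbert).
Implicit Types (x y : V) (xi eta : H).

Lemma tensorDl x y xi eta : tensor (x + y) xi eta = tensor x xi eta + tensor y xi eta.
Proof. by apply: funext => a; apply: funext => b; exact: scalerDr. Qed.

Lemma tensorDm x xi xi' eta : tensor x (xi + xi') eta = tensor x xi eta + tensor x xi' eta.
Proof.
by apply: funext => a; apply: funext => b; rewrite /tensor ipDl mulrDl scalerDl.
Qed.

Lemma tensorDr x xi eta eta' : tensor x xi (eta + eta') = tensor x xi eta + tensor x xi eta'.
Proof.
apply: funext => a; apply: funext => b.
by rewrite /tensor (innerDr (ip_inner H)) mulrDr scalerDl.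
Qed.

Lemma tensorZl (c : C) x xi eta : tensor (c *: x) xi eta = c *: tensor x xi eta.
Proof.
by apply: funext => a; apply: funext => b; rewrite /tensor scalerA mulrC -scalerA.
Qed.

Lemma tensorZm (c : C) x xi eta : tensor x (c *: xi) eta = c *: tensor x xi eta.
Proof.
apply: funext => a; apply: funext => b.
by rewrite /tensor ipZl -mulrA -scalerA.
Qed.

Lemma tensorZr (c : C) x xi eta : tensor x xi (c *: eta) = Cconj c *: tensor x xi eta.
Proof.
apply: funext => a; apply: funext => b.
by rewrite /tensor (innerZr (ip_inner H)) mulrCA -scalerA.
Qed.

Lemma tensor0 xi eta : tensor 0 xi eta = 0 :> (H -> H -> V).
Proof. by rewrite -(scale0r (0 : V)) tensorZl scale0r. Qed.

Lemma tensorN x xi eta : tensor (- x) xi eta = - tensor x xi eta.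
Proof. by rewrite -scaleN1r tensorZl scaleN1r. Qed.
End Tensor.

(** * Cone axioms for the epigraph *)

Section Cone.
Variables (V : LinfMOS) (S : V -> Prop) (H : CHilbert) (phi : V -> H -> H).
Hypotheses (subS : sa_subspace S) (lphi : op_linear_on S phi) (cphi : cgc_on S phi).

Let T := @tensor V H.

(* The epigraph of the sublinear functional
     p(w) = inf { |xi|^2 + phi(B, eta) : w = A.xi + B.eta, nu A <= 1, B over S }.
   Normalising [nu A <= 1] makes it stable under addition, through direct sums. *)
Definition ext_cone (w : H -> H -> V) (r : R) : Prop :=
  exists n (A : mx V n n) (xi : 'I_n -> H) m (B : mx V m m) (eta : 'I_m -> H),
  [/\ is_sa A, (nu A <= 1)%coqR, is_sa B, forall i j, S (B i j) &
   w = qform T A xi + qform T B eta /\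
   r = (sqnorm xi + cre (qform (opform phi) B eta))%coqR].

(** The 0 by 0 matrix equals its own double, so homogeneity forces the value 0. It serves as the
    empty summand in [ext_cone]. *)
Lemma nu_empty (A : mx V 0 0) : nu A = 0%coqR.
Proof.
have saA : is_sa A by case.
have e : mscal (RtoC 2) A = A by apply: funext => -[].
by have := nu_homog (t := 2%coqR) ltac:(lra) saA; rewrite e; lra.
Qed.

Lemma qform0 (M : nmodType) (G : V -> H -> H -> M) (A : mx V 0 0) xi : qform G A xi = 0.
Proof. by rewrite /qform big_ord0. Qed.

Lemma sqnorm0 (xi : 'I_0 -> H) : sqnorm xi = 0%coqR.
Proof. by rewrite /sqnorm /rsum bsumE big_ord0. Qed.

Lemma ext_cone_sub m (B : mx V m m) (eta : 'I_m -> H) : is_sa B -> (forall i j, S (B i j)) ->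
  ext_cone (qform T B eta) (cre (qform (opform phi) B eta)).
Proof.
move=> saB SB; exists 0%N, (fun _ _ => 0), (fun=> 0), m, B, eta.
rewrite qform0 sqnorm0 nu_empty add0r Rplus_0_l; split=> //; [by case | lra].
Qed.

(** The normalisation is met by A / t, and the factor t goes to the vectors as sqrt t, which enters
    twice. Strictness keeps t positive when nu A = 0. *)
Lemma ext_cone_any n (A : mx V n n) (xi : 'I_n -> H) t : is_sa A -> (nu A < t)%coqR ->
  ext_cone (qform T A xi) (t * sqnorm xi)%coqR.
Proof.
move=> saA At; have t0 : (0 < t)%coqR by have := nu_nonneg saA; lra.
have ss : (sqrt t * sqrt t = t)%coqR by apply: sqrt_sqrt; lra.
have it0 := Rinv_0_lt_compat _ t0.
have tt : (/ t * t = 1)%coqR by apply: Rinv_l; lra.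
exists n, (mscal (RtoC (/ t)) A), (fun i => RtoC (sqrt t) *: xi i).
exists 0%N, (fun _ _ => 0), (fun=> 0); split=> //.
- by move=> i j; rewrite /mscal {1}saA svstarZ RtoC_J.
- by rewrite nu_homog //; rewrite -tt; apply: Rmult_le_compat_l; lra.
- by case.
- by case.
- rewrite !qform0 addr0 sqnormZ ss /= Rplus_0_r; split=> //.
  apply: (qform_map (h := id)) => // i j.
  rewrite /T /mscal -[svscal _ _]/(RtoC (/ t) *: A i j).
  rewrite tensorZl tensorZm tensorZr RtoC_J !scalerA -!RtoCM.
  by rewrite Rmult_assoc ss tt scale1r.
Qed.

Lemma ext_cone0 : ext_cone 0 0%coqR.
Proof.
have saA : is_sa (fun (i j : 'I_0) => 0 : V) by case.
have := ext_cone_any (fun=> 0) (t := 1%coqR) saA.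
rewrite nu_empty qform0 sqnorm0 Rmult_0_r; apply; lra.
Qed.

(** Sums come from direct sums. Scaling acts on the vectors by sqrt t and leaves nu A <= 1 intact.
    Positivity over 0 is [tensor_positivity]. *)
Lemma ext_cone_proper : proper_cone ext_cone.
Proof.
have S0 : S 0 by case: subS.
have T0 u v : T 0 u v = 0 by exact: tensor0.
split.
- move=> w w' r r' [n [A [xi [m [B [eta [saA A1 saB SB [-> ->]]]]]]]].
  move=> [n' [A' [xi' [m' [B' [eta' [saA' A1' saB' SB' [-> ->]]]]]]]].
  exists (n + n')%N, (dsum A A'), (catf xi xi').
  exists (m + m')%N, (dsum B B'), (catf eta eta'); split.
  + exact: dsum_sa.
  + by rewrite nu_dsum //; exact: Rmax_lub.
  + exact: dsum_sa.
  + exact: dsum_all.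
  + rewrite !qform_dsum // => [|u v]; last exact: (opform0 subS lphi).
    by rewrite addrACA sqnorm_cat /=; split=> //; lra.
- move=> t w r t0 [n [A [xi [m [B [eta [saA A1 saB SB [-> ->]]]]]]]].
  have ss : (sqrt t * sqrt t = t)%coqR by apply: sqrt_sqrt; lra.
  have qT k (D : mx V k k) z :
      qform T D (fun i => RtoC (sqrt t) *: z i) = RtoC t *: qform T D z.
    apply: (qform_map (h := *:%R (RtoC t))) => [|x y|i j].
    + exact: scaler0.
    + exact: scalerDr.
    + by rewrite /T tensorZm tensorZr RtoC_J scalerA -RtoCM ss.
  have qp : qform (opform phi) B (fun i => RtoC (sqrt t) *: eta i) =
      RtoC t * qform (opform phi) B eta.
    apply: (qform_map (h := *%R (RtoC t))) => [|x y|i j].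
    + exact: mulr0.
    + exact: mulrDr.
    + case: lphi => bphi _; have [_ [hZ _]] := bphi _ (SB i j).
      rewrite /opform -[RtoC _ *: eta j]/(hscal _ _) hZ.
      rewrite -[hscal _ _]/(RtoC (sqrt t) *: phi (B i j) (eta j)) ipZl.
      by rewrite (innerZr (ip_inner H)) RtoC_J mulrA -RtoCM ss.
  exists n, A, (fun i => RtoC (sqrt t) *: xi i), m, B, (fun i => RtoC (sqrt t) *: eta i).
  split=> //; rewrite !qT qp sqnormZ ss -scalerDr /=; split=> //; lra.
- move=> r [n [A [xi [m [B [eta [saA A1 saB SB [w0 ->]]]]]]]].
  exact: (tensor_positivity subS lphi cphi saA A1 SB (esym w0)).
Qed.

Lemma mopp_sa n (A : mx V n n) : is_sa A -> is_sa (mopp A).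
Proof. by move=> saA i j; rewrite /mopp {1}saA; exact: (esym (raddfN (@svstar V) _)). Qed.

Lemma qform_tensorN n (A : mx V n n) xi : qform T (mopp A) xi = - qform T A xi.
Proof.
apply: (qform_map (h := -%R)) => [|x y|i j]; first exact: oppr0.
  exact: opprD.
exact: tensorN.
Qed.

(** Supplies the symmetry that [hahn_banach_cone] asks for. Any finite height will do, so the B part
    is treated as a matrix over V. *)
Lemma ext_coneN w r : ext_cone w r -> exists s, ext_cone (- w) s.
Proof.
move=> [n [A [xi [m [B [eta [saA A1 saB SB [-> _]]]]]]]].
have saA' := mopp_sa saA; have saB' := mopp_sa saB.
exists ((nu (mopp A) + 1) * sqnorm xi + (nu (mopp B) + 1) * sqnorm eta)%coqR.
rewrite opprD -!qform_tensorN; apply: (coneD ext_cone_proper);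
  by apply: ext_cone_any => //; lra.
Qed.
End Cone.

(** * Hermitian tensors *)

Definition Ci : C := mkC 0 1.

Lemma C_rect (c : C) : c = RtoC (cre c) + RtoC (cim c) * Ci.
Proof. by apply: C_ext => /=; lra. Qed.

(** The functional will be controlled only on tensors of self-adjoint matrices, so a single tensor
    is symmetrised first. *)
Definition herm_tensor (V : StarVS) (H : CHilbert) (x : V) (xi eta : H) : H -> H -> V :=
  tensor x xi eta + tensor (svstar x) eta xi.

Section HermTensor.
Variables (V : StarVS) (H : CHilbert).
Implicit Types (x y : V) (xi eta : H).

Lemma herm_tensorDl x y xi eta :
  herm_tensor (x + y) xi eta = herm_tensor x xi eta + herm_tensor y xi eta.
Proof. by rewrite /herm_tensor raddfD /= !tensorDl addrACA. Qed.

Lemma herm_tensorDm x xi xi' eta :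
  herm_tensor x (xi + xi') eta = herm_tensor x xi eta + herm_tensor x xi' eta.
Proof. by rewrite /herm_tensor tensorDm tensorDr addrACA. Qed.

Lemma herm_tensorZ t x xi eta :
  herm_tensor (RtoC t *: x) xi eta = RtoC t *: herm_tensor x xi eta.
Proof. by rewrite /herm_tensor starZ RtoC_J !tensorZl scalerDr. Qed.

Lemma herm_tensorZm c x xi eta :
  herm_tensor x (c *: xi) eta = herm_tensor (c *: x) xi eta.
Proof. by rewrite /herm_tensor tensorZm tensorZr starZ !tensorZl. Qed.

Lemma herm_tensorC x xi eta : herm_tensor (svstar x) eta xi = herm_tensor x xi eta.
Proof. by rewrite /herm_tensor svstarK addrC. Qed.

(* [herm_tensor x xi eta] is twice the real part of [tensor x xi eta]; it is the
   tensor attached to the self-adjoint matrix [offdiag x]. *)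
Definition offdiag x : mx V 2 2 := fun i j =>
  if i == j then 0 else if i == ord0 then svstar x else x.

Definition pair2 xi eta : 'I_2 -> H := fun i => if i == ord0 then xi else eta.

Lemma offdiag_sa x : is_sa (offdiag x).
Proof.
have star0 : svstar 0 = 0 :> V by exact: raddf0.
by move=> i j; rewrite /offdiag; case: (unliftP ord0 i) => [i' ->|->];
  case: (unliftP ord0 j) => [j' ->|->] //=; rewrite ?ord1 ?eqxx /= ?star0 ?svstarK.
Qed.

Lemma qform_offdiag (M : nmodType) (G : V -> H -> H -> M) x xi eta :
  (forall u v, G 0 u v = 0) ->
  qform G (offdiag x) (pair2 xi eta) = G x xi eta + G (svstar x) eta xi.
Proof.
move=> G0; rewrite /qform !big_ord_recl !big_ord0 /= !addr0.
by rewrite /offdiag /pair2 /= !G0 add0r addr0 addrC.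
Qed.

Lemma herm_tensor_qform x xi eta :
  herm_tensor x xi eta = qform (@tensor V H) (offdiag x) (pair2 xi eta).
Proof. by rewrite qform_offdiag // => u v; exact: tensor0. Qed.

Lemma sqnorm_pair2 xi eta : sqnorm (pair2 xi eta) = (rip xi xi + rip eta eta)%coqR.
Proof. by rewrite /sqnorm /rsum bsumE !big_ord_recl big_ord0 /pair2 /=; lra. Qed.

(** Swapping i and j identifies the two halves because A is self-adjoint. The resulting factor 2 is
    undone by the halves in [form]. *)
Lemma sum_herm_tensor n (A : mx V n n) (xi : 'I_n -> H) : is_sa A ->
  qform (@herm_tensor V H) A xi = qform (@tensor V H) A xi + qform (@tensor V H) A xi.
Proof.
move=> saA; rewrite /qform.
under eq_bigr do rewrite big_split /=.
rewrite big_split /=; congr (_ + _); rewrite exchange_big /=.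
by apply: eq_bigr => i _; apply: eq_bigr => j _; rewrite -saA.
Qed.
End HermTensor.

Lemma ip_inj (H : CHilbert) (y z : H) : (forall eta, ip y eta = ip z eta) -> y = z.
Proof.
move=> e; apply/eqP; rewrite -subr_eq0; apply/eqP; apply: (inner_eq0 (ip_inner H)).
by rewrite (innerDl (ip_inner H)) (innerNl (ip_inner H)) e subrr.
Qed.

(** * The sesquilinear form induced by the functional *)

Section Functional.
Variables (V : LinfMOS) (S : V -> Prop) (H : CHilbert) (phi : V -> H -> H).
Hypotheses (subS : sa_subspace S) (lphi : op_linear_on S phi) (cphi : cgc_on S phi).
Let K := ext_cone S phi.
Variable l : (H -> H -> V) -> R.
Hypotheses
  (lD : forall w w' r r', K w r -> K w' r' -> l (w + w') = (l w + l w')%coqR)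
  (lZ : forall w r t, K w r -> l (RtoC t *: w) = (t * l w)%coqR)
  (lK : forall w r, K w r -> (l w <= r)%coqR).

Let L x xi eta := l (@herm_tensor V H x xi eta).

Lemma cone_herm x xi eta t : (nu (offdiag x) < t)%coqR ->
  K (herm_tensor x xi eta) (t * (rip xi xi + rip eta eta))%coqR.
Proof.
move=> h; rewrite herm_tensor_qform -sqnorm_pair2.
exact: (ext_cone_any _ _ _ (offdiag_sa x)).
Qed.

(** The height is immaterial: this only certifies that Hermitian tensors lie where [l] is linear. *)
Let Kh x xi eta : K (herm_tensor x xi eta)
    ((nu (offdiag x) + 1) * (rip xi xi + rip eta eta))%coqR.
Proof. by apply: cone_herm; lra. Qed.

Lemma functionalDl x y xi eta : L (x + y) xi eta = (L x xi eta + L y xi eta)%coqR.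
Proof. by rewrite /L herm_tensorDl; exact: (lD (Kh _ _ _) (Kh _ _ _)). Qed.

Lemma functionalDm x xi xi' eta : L x (xi + xi') eta = (L x xi eta + L x xi' eta)%coqR.
Proof. by rewrite /L herm_tensorDm; exact: (lD (Kh _ _ _) (Kh _ _ _)). Qed.

Lemma functionalC x xi eta : L (svstar x) eta xi = L x xi eta.
Proof. by rewrite /L herm_tensorC. Qed.

Lemma functionalDr x xi eta eta' : L x xi (eta + eta') = (L x xi eta + L x xi eta')%coqR.
Proof. by rewrite -functionalC functionalDm !functionalC. Qed.

Lemma functionalZ t x xi eta : L (RtoC t *: x) xi eta = (t * L x xi eta)%coqR.
Proof. by rewrite /L herm_tensorZ; exact: (lZ _ (Kh _ _ _)). Qed.

Lemma functionalZm c x xi eta : L x (c *: xi) eta = L (c *: x) xi eta.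
Proof. by rewrite /L herm_tensorZm. Qed.

Lemma functionalZr c x xi eta : L x xi (c *: eta) = L (Cconj c *: x) xi eta.
Proof. by rewrite -functionalC functionalZm -functionalC starZ svstarK. Qed.

(** Testing [l] at (xi, s eta) for all real s gives a nonnegative quadratic in s; its discriminant
    replaces the sum of squares by a product of norms. *)
Lemma functional_bound x xi eta t : (nu (offdiag x) < t)%coqR ->
  (L x xi eta / 2 <= t * (hnorm xi * hnorm eta))%coqR.
Proof.
move=> h; have t0 : (0 < t)%coqR by have := nu_nonneg (offdiag_sa x); lra.
have h1 := hnorm_ge0 xi.
have h2 := hnorm_ge0 eta.
have s1 := hnorm_sqr xi.
have s2 := hnorm_sqr eta.
have c0 : (0 <= t * rip eta eta)%coqR by apply: Rmult_le_pos; [lra | exact: rip_ge0].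
have := @quadratic_ge0 (t * rip xi xi) (- (L x xi eta / 2)) (t * rip eta eta) c0.
have q s : (0 <= t * rip xi xi + 2 * s * - (L x xi eta / 2) + s * s * (t * rip eta eta))%coqR.
  have := lK (cone_herm xi (RtoC s *: eta) h).
  rewrite -/(L _ _ _) functionalZr RtoC_J functionalZ ripZl ripZr; lra.
move=> /(_ q); rewrite -s1 -s2 => sq.
have h3 : (0 <= t * (hnorm xi * hnorm eta))%coqR.
  by apply: Rmult_le_pos; [lra | exact: Rmult_le_pos].
apply: Rnot_lt_le => lt; nra.
Qed.

(** The complex form whose real part is L / 2, the Hermitian tensor being twice a real part; the
    imaginary part follows from Im z = - Re (i z). *)
Definition form x xi eta : C := mkC (L x xi eta / 2) (- (L (Ci *: x) xi eta / 2)).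

Lemma formDl x y xi eta : form (x + y) xi eta = form x xi eta + form y xi eta.
Proof. by apply: C_ext => /=; rewrite ?scalerDr functionalDl; lra. Qed.

Lemma formZl c x xi eta : form (c *: x) xi eta = c * form x xi eta.
Proof.
have LZ d y : L (d *: y) xi eta = (cre d * L y xi eta + cim d * L (Ci *: y) xi eta)%coqR.
  by rewrite {1}[d]C_rect scalerDl -scalerA functionalDl !functionalZ.
have e := LZ (Ci * c) x; rewrite -scalerA /= in e.
by apply: C_ext => /=; rewrite ?(LZ c) ?e; lra.
Qed.

Lemma formDm x xi xi' eta : form x (xi + xi') eta = form x xi eta + form x xi' eta.
Proof. by apply: C_ext => /=; rewrite functionalDm; lra. Qed.

Lemma formZm c x xi eta : form x (c *: xi) eta = c * form x xi eta.
Proof.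
rewrite -formZl; apply: C_ext => /=; rewrite functionalZm //.
by rewrite !scalerA mulrC.
Qed.

Lemma formC x xi eta : form (svstar x) eta xi = Cconj (form x xi eta).
Proof.
have e : Ci *: svstar x = svstar (RtoC (-1) *: (Ci *: x)).
  by rewrite !starZ scalerA; congr (_ *: _); apply: C_ext => /=; lra.
apply: C_ext => /=; rewrite ?e functionalC ?functionalZ //; lra.
Qed.

(** Riesz matches the real parts; the imaginary ones follow by testing against i eta, since Im <y,
    eta> = Re <y, i eta>. *)
Lemma form_represented x xi : exists y : H, forall eta, ip y eta = form x xi eta.
Proof.
have [||eta|y yP] := @riesz H (fun eta => L x xi eta / 2)%coqR
    ((nu (offdiag x) + 1) * hnorm xi).
- by move=> eta eta'; rewrite functionalDr; lra.
- by move=> t eta; rewrite functionalZr RtoC_J functionalZ; lra.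
- rewrite Rmult_assoc; apply: functional_bound; lra.
exists y => eta; apply: C_ext => /=; first by rewrite yP.
have -> : cim (ip y eta) = rip y (Ci *: eta).
  by rewrite /rip (innerZr (ip_inner H)) /=; lra.
rewrite -yP functionalZr (_ : Cconj Ci = RtoC (-1) * Ci); last first.
  by apply: C_ext => /=; lra.
by rewrite -scalerA functionalZ; lra.
Qed.

(** Additivity of [l] is known only over the cone, so membership of the partial sums is proved along
    with their values. *)
Lemma functional_sum n (A : mx V n n) (xi : 'I_n -> H) :
  l (qform (@herm_tensor V H) A xi) =
  \big[Rplus/0%coqR]_i \big[Rplus/0%coqR]_j L (A i j) (xi j) (xi i).
Proof.
have Kproper : proper_cone K := ext_cone_proper subS lphi cphi.
have l0 : l 0 = 0%coqR.
  have e : RtoC 0 *: (0 : H -> H -> V) = 0 by exact: scaler0.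
  by have := lZ 0 (ext_cone0 S phi); rewrite e Rmult_0_l.
have sumK (I : Type) (s : seq I) F (G : I -> R) :
    (forall i, (exists r, K (F i) r) /\ l (F i) = G i) ->
    (exists r, K (\sum_(i <- s) F i) r) /\
    l (\sum_(i <- s) F i) = \big[Rplus/0%coqR]_(i <- s) G i.
  move=> FG; elim/big_rec2: _ => [|i y x _ [[r Kr] <-]].
    by split=> //; exists 0%coqR; exact: ext_cone0.
  have [[r' Kr'] <-] := FG i; split; last exact: lD Kr' Kr.
  by exists (r' + r)%coqR; exact: (coneD Kproper).
apply: (sumK _ _ _ _ _).2 => i; apply: sumK => j; split=> //.
by exists ((nu (offdiag (A i j)) + 1) * (rip (xi j) (xi j) + rip (xi i) (xi i)))%coqR.
Qed.

(** The real part on the left is half of l(2 A.xi), that is l(A.xi), and A.xi has height t |xi|^2 in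
    the cone. *)
Lemma form_contractive n (A : mx V n n) (xi : 'I_n -> H) t : is_sa A -> (nu A < t)%coqR ->
  (cre (qform form A xi) <= t * sqnorm xi)%coqR.
Proof.
move=> saA At; have KA := ext_cone_any S phi xi saA At.
apply: Rle_trans (lK KA); apply: Req_le.
have := functional_sum A xi; rewrite sum_herm_tensor // (lD KA KA).
have -> : cre (qform form A xi) =
    (/ 2 * \big[Rplus/0%coqR]_i \big[Rplus/0%coqR]_j L (A i j) (xi j) (xi i))%coqR.
  have hD x y : (/ 2 * (x + y) = / 2 * x + / 2 * y)%coqR by lra.
  have h0 : (/ 2 * 0 = 0)%coqR by lra.
  rewrite cre_sum (big_morph (Rmult (/ 2)) hD h0); apply: eq_bigr => i _.
  rewrite cre_sum (big_morph (Rmult (/ 2)) hD h0); apply: eq_bigr => j _ /=.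
  lra.
lra.
Qed.

(** Over [S] the tensor of [offdiag y] and its negative have opposite heights in the cone, which
    pins [l] from both sides. *)
Lemma form_extends x xi eta : S x -> form x xi eta = ip (phi x xi) eta.
Proof.
move=> Sx.
have S0 : S 0 by case: subS.
have LS y : S y -> L y xi eta = (2 * rip (phi y xi) eta)%coqR.
  move=> Sy; have Sys : S (svstar y) by case: subS => _ [_ [_]]; apply.
  have So i j : S (offdiag y i j).
    by rewrite /offdiag; case: (i == j) => //; case: (i == ord0).
  have SN i j : S (mopp (offdiag y) i j).
    rewrite /mopp -[svopp _]/(- offdiag y i j) -scaleN1r.
    by case: subS => _ [_ [h _]]; exact: h.
  have f0 u v : opform phi 0 u v = 0 by exact: (opform0 subS lphi).
  (* The adjoint relation for [phi] makes the two off-diagonal terms conjugate, so their real parts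
     add up to the factor 2. *)
  have fE : cre (qform (opform phi) (offdiag y) (pair2 xi eta)) =
      (2 * rip (phi y xi) eta)%coqR.
    rewrite qform_offdiag // /opform; case: cphi => adj _.
    by rewrite (adj _ Sys) svstarK -(ipJ (phi y xi)) /rip /=; lra.
  have k1 := ext_cone_sub phi (pair2 xi eta) (offdiag_sa y) So.
  have k2 := ext_cone_sub phi (pair2 xi eta) (mopp_sa (offdiag_sa y)) SN.
  have fN : qform (opform phi) (mopp (offdiag y)) (pair2 xi eta) =
      - qform (opform phi) (offdiag y) (pair2 xi eta).
    apply: (qform_map (h := -%R)) => [|u v|i j]; first exact: oppr0.
      exact: opprD.
    rewrite /mopp -[svopp _]/(- offdiag y i j) -scaleN1r (opformZl lphi) //.
    by rewrite mulN1r.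
  rewrite qform_tensorN fN opp_scal -herm_tensor_qform in k2.
  rewrite -herm_tensor_qform fE in k1.
  have := lK k1; have := lK k2; rewrite (lZ _ k1) /= fE -/(L _ _ _); lra.
have SCx : S (Ci *: x) by case: subS => _ [_ [h _]]; exact: h.
apply: C_ext => /=; rewrite LS // /rip; first by lra.
have -> : ip (phi (Ci *: x) xi) eta = Ci * ip (phi x xi) eta by exact: (opformZl lphi).
by rewrite /=; lra.
Qed.
End Functional.

(** * Assembling the extension *)

Theorem theorem3p14 (V : LinfMOS) (S : V -> Prop) (H : CHilbert) (phi : V -> H -> H) :
  sa_subspace S ->
  op_linear_on S phi ->
  cgc_on S phi ->
  exists psi : V -> H -> H,
    op_linear_on (fun _ => True) psi /\
    cgc_on (fun _ => True) psi /\
    (forall x, S x -> forall xi, psi x xi = phi x xi).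
Proof.
move=> subS lphi cphi.
have [l [lD lZ lK]] := hahn_banach_cone (ext_cone_proper subS lphi cphi)
  (ext_cone0 S phi) (@ext_coneN _ _ _ _ subS lphi cphi).
have rep (p : V * H) := form_represented lD lZ lK p.1 p.2.
have [psi0 psi0P] := choice rep.
pose psi x xi := psi0 (x, xi); exists psi.
have psiP x xi eta : ip (psi x xi) eta = form l x xi eta by exact: (psi0P (x, xi)).
split; [split; [|split]|split; [split|]].
- move=> x _; split; [|split].
  + move=> xi xi'; apply: ip_inj => eta; rewrite psiP (formDm lD).
    by rewrite ip_addl !psiP.
  + move=> a xi; apply: ip_inj => eta; rewrite psiP (formZm lD lZ).
    by rewrite ip_scall !psiP.
  + have h : (nu (offdiag x) < nu (offdiag x) + 1)%coqR by lra.
    exists (nu (offdiag x) + 1)%coqR => xi.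
    (* Testing the bound at eta = psi x xi gives |psi x xi|^2 <= t |xi| |psi x xi|, where |psi x xi|
       is cancelled if nonzero. *)
    have := functional_bound lZ lK xi (psi x xi) h.
    have -> : (l (herm_tensor x xi (psi x xi)) / 2 = rip (psi x xi) (psi x xi))%coqR.
      by rewrite /rip psiP.
    rewrite -hnorm_sqr.
    have h1 := hnorm_ge0 xi.
    case: (hnorm_ge0 (psi x xi)) => [p0|<-] hle.
      by apply: (Rmult_le_reg_r _ _ _ p0); lra.
    by apply: Rmult_le_pos => //; have := nu_nonneg (offdiag_sa x); lra.
- move=> x y _ _ xi; apply: ip_inj => eta; rewrite psiP (formDl lD).
  by rewrite ip_addl !psiP.
- move=> a x _ xi; apply: ip_inj => eta; rewrite psiP (formZl lD lZ).
  by rewrite ip_scall !psiP.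
- move=> x _ xi eta; rewrite psiP.
  by rewrite -(ipJ (psi _ eta)) psiP (formC lZ) CconjK.
- move=> n A _ saA; apply: d_BH_le => [t At|]; last exact: nu_nonneg.
  apply/op_le_tIE => xi.
  have -> : qform (opform psi) A xi = qform (form l) A xi.
    by apply: eq_bigr => i _; apply: eq_bigr => j _; exact: psiP.
  exact: (form_contractive subS lphi cphi lD lZ lK).
- move=> x Sx xi; apply: ip_inj => eta; rewrite psiP.
  exact: (form_extends subS lphi cphi lZ lK).
Qed.
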